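(* Let $\beta$ be a fixed non-negative integer. The problem \textsc{pLS-Vertex Cover} restricted to $\beta$-separable graphs is fixed-parameter tractable: there is an algorithm solving it in time $2^q q^{O(\log q)} n^{O(1)}$, where $q=k+\beta k$ and $n$ is the number of vertices of the input graph.
   Context: All graphs are finite, undirected and simple. A vertex cover of $G=(V,E)$ is a set $S\subseteq V$ meeting every edge. For sets $S_1,S_2$, $\mathrm{dist}(S_1,S_2)=|S_1\cup S_2|-|S_1\cap S_2|$. \textsc{pLS-Vertex Cover} (permissive local search for vertex cover): the input is a graph $G$, a vertex cover $S$ of $G$, and a positive integer $k$ (the parameter); the task is either to determine that $G$ has no vertex cover $S'$ with $\mathrm{dist}(S,S')\le k$ and $|S'|<|S|$, or to find a vertex cover $S''$ of $G$ with $|S''|<|S|$ (not necessarily within distance $k$ of $S$). For a fixed non-negative integer $\beta$, a graph $G=(V,E)$ is $\beta$-separable if $V$ can be partitioned into $V_1$ and $V_2$ such that every $v\in V_1$ satisfies $|N(v)\cap V_1|\le\beta$ and every $w\in V_2$ satisfies $|N(w)|\le\beta$. *)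

(* Defs.v *)
From mathcomp Require Import all_boot.

Set Implicit Arguments.
Unset Strict Implicit.
Unset Printing Implicit Defensive.

(* Model of computation: first-order call-by-value programs over binary trees
   (pure LISP).  The running time counts one unit per evaluated subexpression.
   For a fixed program every rule below is O(1) work on a pointer machine or a
   word RAM (trees are shared, environments have length bounded by the program
   text), and a RAM is simulated with a logarithmic overhead, memory being kept
   in a balanced tree.  Bounds of the form 2^q q^O(log q) n^O(1) are therefore
   the same in this model and on a RAM. *)

Inductive tree := Leaf | Node of tree & tree.

Inductive expr :=
| Var of nat                    (* de Bruijn index in the environment *)
| Lf
| Nd of expr & expr
| Let of expr & expr
| Case of expr & expr & expr    (* the Node branch binds the left subtree as
                                   variable 0 and the right one as variable 1 *)
| Call of nat & expr.           (* call of the i-th function of the program *)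

(* The bodies of mutually recursive unary functions; variable 0 is the argument
   and function 0 is the entry point. *)
Definition program := seq expr.

Inductive eval (p : program) : seq tree -> expr -> tree -> nat -> Prop :=
| EvVar s i : eval p s (Var i) (nth Leaf s i) 1
| EvLf s : eval p s Lf Leaf 1
| EvNd s a b u v t1 t2 :
    eval p s a u t1 -> eval p s b v t2 ->
    eval p s (Nd a b) (Node u v) (t1 + t2).+1
| EvLet s a b u v t1 t2 :
    eval p s a u t1 -> eval p (u :: s) b v t2 ->
    eval p s (Let a b) v (t1 + t2).+1
| EvCaseLf s a b c v t1 t2 :
    eval p s a Leaf t1 -> eval p s b v t2 ->
    eval p s (Case a b c) v (t1 + t2).+1
| EvCaseNd s a b c x y v t1 t2 :
    eval p s a (Node x y) t1 -> eval p [:: x, y & s] c v t2 ->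
    eval p s (Case a b c) v (t1 + t2).+1
| EvCall s i a u v t1 t2 :
    eval p s a u t1 -> eval p [:: u] (nth Lf p i) v t2 ->
    eval p s (Call i a) v (t1 + t2).+1.

Definition runs (p : program) (input output : tree) (time : nat) : Prop :=
  eval p [:: input] (nth Lf p 0) output time.

Lemma eval_det p s e v1 t1 v2 t2 :
  eval p s e v1 t1 -> eval p s e v2 t2 -> v1 = v2 /\ t1 = t2.
Proof.
move=> H; elim: H v2 t2 => {s e v1 t1}.
- by move=> s i v t E; inversion E.
- by move=> s v t E; inversion E.
- move=> s a b u v t1 t2 _ IH1 _ IH2 w t E.
  inversion E as [| |? ? ? ? ? ? ? E1 E2| | | |]; subst.
  by have [-> ->] := IH1 _ _ E1; have [-> ->] := IH2 _ _ E2.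
- move=> s a b u v t1 t2 _ IH1 _ IH2 w t E.
  inversion E as [| | |? ? ? ? ? ? ? E1 E2| | |]; subst.
  have [eu ->] := IH1 _ _ E1; rewrite -eu in E2.
  by have [-> ->] := IH2 _ _ E2.
- move=> s a b c v t1 t2 _ IH1 _ IH2 w t E.
  inversion E as [| | | |? ? ? ? ? ? ? E1 E2|? ? ? ? ? ? ? ? ? E1 E2|]; subst.
    by have [_ ->] := IH1 _ _ E1; have [-> ->] := IH2 _ _ E2.
  by have [] := IH1 _ _ E1.
- move=> s a b c x y v t1 t2 _ IH1 _ IH2 w t E.
  inversion E as [| | | |? ? ? ? ? ? ? E1 E2|? ? ? ? ? ? ? ? ? E1 E2|]; subst.
    by have [] := IH1 _ _ E1.
  have [[ex ey] ->] := IH1 _ _ E1; rewrite -ex -ey in E2.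
  by have [-> ->] := IH2 _ _ E2.
- move=> s i a u v t1 t2 _ IH1 _ IH2 w t E.
  inversion E as [| | | | | |? ? ? ? ? ? ? E1 E2]; subst.
  have [eu ->] := IH1 _ _ E1; rewrite -eu in E2.
  by have [-> ->] := IH2 _ _ E2.
Qed.

Fixpoint tree_size (u : tree) : nat :=
  if u is Node a b then (tree_size a + tree_size b).+1 else 1.

Definition list_tree : seq tree -> tree := foldr Node Leaf.

Definition bool_tree (b : bool) : tree := if b then Node Leaf Leaf else Leaf.

(* Unary; time bounds below are at least 2^k, so that converting between the
   unary and the binary notation of the parameter k is negligible. *)
Definition nat_tree (m : nat) : tree := list_tree (nseq m Leaf).

Definition computable (f : nat -> nat) : Prop :=
  exists p : program, forall m, exists t, runs p (nat_tree m) (nat_tree (f m)) t.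

(* A parameterized search problem: [answer x v] says that the output [v] is
   correct for the instance [x].  Inputs satisfying [valid] are the ones the
   problem is posed on. *)
Record param_problem := ParamProblem {
  instance : Type;
  valid : instance -> Prop;
  encode : instance -> tree;
  parameter : instance -> nat;
  answer : instance -> tree -> Prop
}.

Definition solvable_in_time (P : param_problem) (T : instance P -> nat) : Prop :=
  exists p : program, forall x : instance P, valid x ->
    exists (v : tree) (t : nat),
      [/\ runs p (encode x) v t, answer x v & t <= T x].

Definition fixed_parameter_tractable (P : param_problem) : Prop :=
  exists (f : nat -> nat) (c : nat), computable f /\
    @solvable_in_time P
      (fun x => f (parameter x) * tree_size (encode x) ^ c).

Record sgraph (V : finType) := SGraph {
  adj :> rel V;
  adj_sym : symmetric adj;
  adj_irrefl : irreflexive adj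
}.

Definition neighbors (V : finType) (G : sgraph V) (v : V) : {set V} := [set w | G v w].

Definition vertex_cover (V : finType) (G : sgraph V) (S : {set V}) : Prop :=
  forall u v, G u v -> (u \in S) || (v \in S).

Definition dist (V : finType) (S1 S2 : {set V}) : nat := #|S1 :|: S2| - #|S1 :&: S2|.

Definition separable (V : finType) (G : sgraph V) (beta : nat) : Prop :=
  exists V1 V2 : {set V},
    [/\ V1 :|: V2 = [set: V], [disjoint V1 & V2],
        (forall v, v \in V1 -> #|neighbors G v :&: V1| <= beta) &
        (forall w, w \in V2 -> #|neighbors G w| <= beta)].

Record pls_vc_instance := PlsVcInstance {
  nverts : nat;
  graph : sgraph 'I_nverts;
  cover : {set 'I_nverts};
  radius : nat
}.

Definition set_tree n (S : {set 'I_n}) : tree :=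
  list_tree [seq bool_tree (i \in S) | i <- enum 'I_n].

(* Adjacency matrix, row by row. *)
Definition graph_tree n (G : sgraph 'I_n) : tree :=
  list_tree [seq set_tree (neighbors G i) | i <- enum 'I_n].

Definition pls_vc_encode (x : pls_vc_instance) : tree :=
  list_tree [:: graph_tree (graph x); set_tree (cover x); nat_tree (radius x)].

(* The output [Leaf] claims that no smaller vertex cover is within the given
   distance; the output [Node Leaf w] presents the set encoded by [w]. *)
Definition pls_vc_answer (x : pls_vc_instance) (v : tree) : Prop :=
  (v = Leaf /\
   ~ exists S' : {set 'I_(nverts x)},
       [/\ vertex_cover (graph x) S', dist (cover x) S' <= radius x
         & #|S'| < #|cover x|])
  \/
  (exists S'' : {set 'I_(nverts x)},
     [/\ v = Node Leaf (set_tree S''), vertex_cover (graph x) S''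
       & #|S''| < #|cover x|]).

Definition pls_vc (beta : nat) : param_problem := {|
  instance := pls_vc_instance;
  valid := fun x => [/\ vertex_cover (graph x) (cover x), 0 < radius x
                      & separable (graph x) beta];
  encode := pls_vc_encode;
  parameter := radius;
  answer := pls_vc_answer
|}.

(* 2^q q^O(log q) n^O(1), with one constant [c] for all the hidden ones.  The
   base is [n.+1] so that the bound does not vanish on the empty graph; for
   n > 0 it differs from n^O(1) by a constant factor only.  The binary logarithm
   is rounded down, which for q > 1 changes it by a factor less than 2. *)
Definition time_bound (c q n : nat) : nat :=
  c * (2 ^ q * q ^ (c * trunc_log 2 q) * n.+1 ^ c).

(* Main.v *)
(** Let [S] be a vertex cover.  A smaller cover at distance at most [k] exists
    only if some independent [A] inside [S] with at most [(k+1)/2] elements has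
    fewer than [#|A|] neighbours outside [S]; and any independent [A] with fewer
    than [#|A|] neighbours outside [S] gives a smaller cover.

    The low-degree vertices of the partition may be taken to be all vertices of
    degree at most [beta].  Colour the vertices, keep the green vertices of [S],
    and delete a kept vertex of low degree with a kept neighbour and a kept vertex
    of high degree with a kept neighbour of high degree.  The survivors are
    independent, and [A] survives if [A] is green and at most [beta * #|A|]
    further vertices are not.  Among independent survivors the smaller cover comes
    from a violation of Hall's condition, found in polynomial time by an auction.

    The colourings are all sequences produced by binary linear recurrences of
    order [m], with [2 ^ m > n * 2 ^ s] for the number [s <= (1+beta)(k+1)/2] of
    vertices whose colour matters.  In the field with [2 ^ m] elements fewer than
    [n * 2 ^ s] points [x] make the [s] relevant powers of [x] linearly dependent
    over F_2; for any other [x] a linear form [phi] takes prescribed values on these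
    powers, and every [t |-> phi (y * x ^ t)] is such a sequence.  There are
    [4 ^ m] sequences, that is [2 ^ q n^O(1)] with [q = (1+beta) k]. *)

From mathcomp Require Import all_boot all_algebra all_field zify.
Require Import Defs.

Set Implicit Arguments.
Unset Strict Implicit.
Unset Printing Implicit Defensive.

(** * Improving a vertex cover *)

Lemma leq_card_bigcup (I T : finType) (A : {set I}) (F : I -> {set T}) :
  #|\bigcup_(i in A) F i| <= \sum_(i in A) #|F i|.
Proof.
elim/big_rec2: _ => [|i m B _ le_Bm]; first by rewrite cards0.
by rewrite (leq_trans (leq_card_setU _ _)) // leq_add2l.
Qed.

Section VertexCovers.
Variables (V : finType) (G : sgraph V).
Implicit Types (u v : V) (A B I S W : {set V}).

Definition neighborhood A : {set V} := \bigcup_(v in A) neighbors G v.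

Definition independent A : Prop := {in A &, forall u v, ~~ G u v}.

Definition freed I S B : {set V} := [set v in I | neighbors G v :\: S \subset B].

Definition exchange I S B : {set V} := (S :\: freed I S B) :|: (B :\: S).

Lemma vertex_cover_exchange I S B :
  independent I -> vertex_cover G S -> vertex_cover G (exchange I S B).
Proof.
move=> indepI coverS; suff covered u v : G u v -> u \in S ->
    (u \in exchange I S B) || (v \in exchange I S B).
  move=> u v Guv; have /orP[/covered->//|vS] := coverS u v Guv.
  by rewrite orbC covered // adj_sym.
move=> Guv uS; rewrite !inE uS /= orbF andbT.
have [/andP[uI /subsetP sub_uB] /=|//] := boolP (_ && _).
have [vS|vS] /= := boolP (v \in S); last by rewrite sub_uB ?orbT // !inE vS.
by rewrite orbF andbT; apply: contraL Guv => /andP[vI _]; apply: indepI.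
Qed.

Lemma card_exchange I S B :
  I \subset S -> #|exchange I S B| + #|freed I S B| <= #|S| + #|B|.
Proof.
move=> sub_IS; have sub_freed : freed I S B \subset S.
  by apply: subset_trans sub_IS; rewrite /freed setIdE subsetIl.
rewrite -(cardsID (freed I S B) S) (setIidPr sub_freed) addnC -addnA leq_add2l.
rewrite (leq_trans (leq_card_setU _ _)) // leq_add2l.
by rewrite subset_leq_card ?subsetDl.
Qed.

Lemma improving_subset S S' k :
  vertex_cover G S' -> #|S'| < #|S| -> dist S S' <= k ->
  exists A, [/\ A \subset S, independent A, #|neighborhood A :\: S| < #|A|
              & #|A| <= uphalf k].
Proof.
move=> cover' lt_S' le_k; have card_U := cardsUI S S'.
have card_S := cardsID S' S; have card_S' := cardsID S S'; rewrite setIC in card_S'.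
have lt_diff : #|S' :\: S| < #|S :\: S'| by lia.
have [s [uniq_s size_s sub_s]] := card_geqP lt_diff.
have card_s : #|[set x in s]| = #|S' :\: S|.+1.
  by rewrite cardsE -size_s; apply/card_uniqP.
have sS x : x \in s -> (x \in S) * (x \in S' = false).
  by move/sub_s; rewrite inE => /andP[/negbTE-> ->].
exists [set x in s]; rewrite card_s; split.
- by apply/subsetP => x; rewrite inE => /sS->.
- move=> u v; rewrite !inE => /sS us /sS vs; apply/negP => /cover'.
  by rewrite us vs.
- rewrite ltnS subset_leq_card //; apply/subsetP => v.
  rewrite 2!inE => /andP[vS /bigcupP[u]]; rewrite !inE vS => /sS us /cover'.
  by rewrite us.
by move: le_k; rewrite /dist; lia.
Qed.

End VertexCovers.

(** * Separable graphs *)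

Section SeparableGraphs.
Variables (V : finType) (G : sgraph V) (beta : nat).
Implicit Types (u v : V) (A W : {set V}).

Definition low_degree : {set V} := [set v | #|neighbors G v| <= beta].

Definition conflicts v : {set V} :=
  if v \in low_degree then neighbors G v else neighbors G v :\: low_degree.

Definition survivors W : {set V} := [set v in W | [disjoint conflicts v & W]].

Lemma card_conflicts v : separable G beta -> #|conflicts v| <= beta.
Proof.
case=> V1 [V2 [V12 _ V1P V2P]]; rewrite /conflicts; case: ifPn => [|v_high].
  by rewrite inE.
have high_V1 u : u \notin low_degree -> u \in V1.
  move=> u_high; have : u \in V1 :|: V2 by rewrite V12 inE.
  by rewrite inE => /orP[//|/V2P u_low]; rewrite inE u_low in u_high.
apply: leq_trans (V1P v (high_V1 v v_high)); apply/subset_leq_card/subsetP => u.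
by rewrite !inE => /andP[u_high ->]; apply: high_V1; rewrite inE.
Qed.

Lemma card_bigcup_conflicts A :
  separable G beta -> #|A :|: \bigcup_(v in A) conflicts v| <= beta.+1 * #|A|.
Proof.
move=> sep; rewrite (leq_trans (leq_card_setU _ _)) // mulSn leq_add2l.
apply: leq_trans (leq_card_bigcup _ _) _; rewrite mulnC -sum_nat_const.
by apply: leq_sum => v _; apply: card_conflicts.
Qed.

Lemma sub_conflicts v : conflicts v \subset neighbors G v.
Proof. by rewrite /conflicts; case: ifP => // _; rewrite subsetDl. Qed.

Lemma independent_disjoint_conflicts A :
  independent G A -> [disjoint A & \bigcup_(v in A) conflicts v].
Proof.
move=> indepA; apply: bigcup_disjoint => v vA.
rewrite (disjointWr (sub_conflicts v)) // disjoint_subset; apply/subsetP => u uA.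
by rewrite !inE indepA.
Qed.

Lemma sub_survivors A W :
  A \subset W -> [disjoint \bigcup_(v in A) conflicts v & W] ->
  A \subset survivors W.
Proof.
move=> /subsetP sub_AW disj; apply/subsetP => v vA; rewrite inE sub_AW //=.
by apply: disjointWl disj; apply: bigcup_sup.
Qed.

Lemma survivors_sub W : survivors W \subset W.
Proof. by rewrite /survivors setIdE subsetIl. Qed.

Lemma survivors_independent W : independent G (survivors W).
Proof.
move=> u v; rewrite !inE => /andP[uW du] /andP[vW dv]; apply/negP => Guv.
have conflict_uv : (v \in conflicts u) || (u \in conflicts v).
  have Gvu : G v u by rewrite adj_sym.
  rewrite /conflicts; case: ifP => u_low; first by rewrite inE Guv.
  by case: ifP => v_low; rewrite ?in_setD ?v_low !inE ?Guv ?Gvu ?orbT.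
by case/orP: conflict_uv => [/(disjointFr du)|/(disjointFr dv)]; rewrite ?uW ?vW.
Qed.

End SeparableGraphs.

(** * Bit vectors *)

Fixpoint bits_diff (a b : bitseq) : bitseq :=
  match a, b with
  | x :: a', y :: b' => (x && ~~ y) :: bits_diff a' b'
  | _, _ => a
  end.

Definition overlap (a b : bitseq) : nat := count id (bits_diff a (bits_diff a b)).

Lemma size_bits_diff a b : size (bits_diff a b) = size a.
Proof. by elim: a b => [|x a IH] [|y b] //=; rewrite IH. Qed.

Lemma nth_bits_diff a b i :
  nth false (bits_diff a b) i = nth false a i && ~~ nth false b i.
Proof. by elim: a b i => [|x a IH] [|y b] [|i] //=; rewrite ?nth_nil ?andbT. Qed.

Lemma overlap_le_size a b : overlap a b <= size a.
Proof. by rewrite (leq_trans (count_size _ _)) // size_bits_diff. Qed.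

Lemma count_id_sum (a : bitseq) : count id a = \sum_(i < size a) nth false a i.
Proof. by elim: a => [|x a IH] /=; rewrite ?big_ord0 // big_ord_recl IH. Qed.

Lemma overlap_sum a b :
  overlap a b = \sum_(i < size a) (nth false a i && nth false b i).
Proof.
rewrite /overlap count_id_sum size_bits_diff; apply: eq_bigr => i _.
by rewrite !nth_bits_diff negb_and negbK andb_orr andbN.
Qed.

Definition bits_sub (a b : bitseq) : bool := count id (bits_diff a b) == 0.

Lemma bits_subP a b :
  reflect (forall i, nth false a i -> nth false b i) (bits_sub a b).
Proof.
rewrite /bits_sub eqn0Ngt -has_count.
apply: (iffP hasPn) => [sub i a_i|sub _ /(nthP false)[i _ <-]].
  have lt_i : i < size (bits_diff a b).
    by rewrite size_bits_diff ltnNge; apply: contraL a_i => /(nth_default _)->.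
  by have := sub _ (mem_nth false lt_i); rewrite nth_bits_diff a_i negbK.
by rewrite nth_bits_diff; apply/negP => /andP[/sub->].
Qed.

(** * Linear recurrences over F_2 *)

Definition dot (f w : bitseq) : bool := odd (overlap f w).

(* [f] holds the feedback taps and [w] the bits so far, the most recent first. *)
Fixpoint lfsr (n : nat) (w f : bitseq) : bitseq :=
  if n is n'.+1 then lfsr n' (dot f w :: w) f else w.

Definition recurrent (f : bitseq) (r : nat -> bool) : Prop :=
  forall t, size f <= t -> r t = dot f (rev (mkseq r t)).

Lemma lfsr_recurrent f r n t : recurrent f r -> size f <= t ->
  lfsr n (rev (mkseq r t)) f = rev (mkseq r (t + n)).
Proof.
move=> rec; elim: n t => [|n IH] t le_t /=; first by rewrite addn0.
by rewrite -rec // -rev_rcons -mkseqS IH ?addSnnS // leqW.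
Qed.

Section FiniteFields.
Local Open Scope ring_scope.
Import GRing.Theory.

Lemma exists_common_nonroot (F : finFieldType) (I : finType) (p : I -> {poly F})
    (P : {set I}) (d : nat) :
  {in P, forall i, p i != 0} -> {in P, forall i, (size (p i) <= d.+1)%N} ->
  (#|P| * d < #|F|)%N -> exists x, {in P, forall i, ~~ root (p i) x}.
Proof.
move=> p_neq0 size_p lt_F; pose q := \prod_(i in P) p i.
have q_neq0 : q != 0 by apply/prodf_neq0 => i; apply: p_neq0.
have size_q : (size q <= (#|P| * d).+1)%N.
  rewrite size_prod // leq_subLR addnS ltnS -mulnS -sum_nat_const.
  by apply: leq_sum => i; apply: size_p.
have [x q_x] : exists x, ~~ root q x.
  apply/existsP; rewrite -negb_forall; apply/negP => /forallP all_root.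
  have roots_enum : all (root q) (enum F) by apply/allP => x _; apply: all_root.
  have := max_poly_roots q_neq0 roots_enum (enum_uniq _); rewrite -cardE.
  by move/(leq_ltn_trans lt_F); rewrite ltnNge size_q.
by exists x => i iP; apply: contra q_x; rewrite /q (bigD1 i) //= rootM => ->.
Qed.

Lemma exists_nonzero_power_sums (F : finFieldType) (I : finType) (e : I -> nat)
    (d : nat) :
  injective e -> (forall i, e i <= d)%N -> (2 ^ #|I| * d < #|F|)%N ->
  exists x : F, forall U : {set I}, U != set0 -> \sum_(i in U) x ^+ e i != 0.
Proof.
move=> inj_e le_d lt_F; pose p (U : {set I}) : {poly F} := \sum_(i in U) 'X^(e i).
have p_neq0 : {in [set~ set0], forall U : {set I}, p U != 0}.
  move=> U; rewrite !inE => /set0Pn[i iU].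
  apply/eqP => /(congr1 (fun q : {poly F} => q`_(e i))); rewrite coef0 coef_sum.
  rewrite (bigD1 i) //= coefXn eqxx big1 ?addr0 => [/eqP|j /andP[_ ji]].
    by rewrite oner_eq0.
  by rewrite coefXn (inj_eq inj_e) eq_sym (negbTE ji).
have size_p : {in [set~ set0], forall U : {set I}, (size (p U) <= d.+1)%N}.
  move=> U _; rewrite (leq_trans (size_sum _ _ _)) //; apply/bigmax_leqP => i _.
  by rewrite size_polyXn ltnS.
have [|x xP] := exists_common_nonroot p_neq0 size_p.
  rewrite (leq_ltn_trans _ lt_F) // leq_mul2r -cardsT -card_powerset.
  by rewrite subset_leq_card ?orbT //; apply/subsetP => U; rewrite powersetT.
exists x => U U_neq0; have := xP U; rewrite !inE => /(_ U_neq0).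
rewrite rootE horner_sum; under eq_bigr => i _ do rewrite hornerXn.
by [].
Qed.

Lemma F2_natr (c : 'F_2) : c = (c != 0)%:R.
Proof. by case: c => [[|[|]]] // i; apply: val_inj. Qed.

Lemma F2_natr_neq0 m : (m%:R != 0 :> 'F_2) = odd m.
Proof. by rewrite -(dvdn_pcharf (pchar_Fp _)) // dvdn2 negbK. Qed.

Lemma exists_F2_linear_form (L : vectType 'F_2) (I : finType) (v : I -> L)
    (b : I -> 'F_2) :
  (forall U : {set I}, U != set0 -> \sum_(i in U) v i != 0) ->
  exists phi : {linear L -> ('F_2)^o}, forall i, phi (v i) = b i.
Proof.
move=> sum_neq0; pose X := [tuple v (enum_val j) | j < #|I|].
have freeX : free X.
  apply/freeP => k.
  under eq_bigr => j _ do rewrite -tnth_nth tnth_mktuple (F2_natr (k j)).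
  move=> sum0 j0; apply/eqP; apply: contraT => k_j0.
  have /sum_neq0/eqP[] : [set i | k (enum_rank i) != 0] != set0.
    by apply/set0Pn; exists (enum_val j0); rewrite inE enum_valK.
  rewrite -[RHS]sum0 [RHS](reindex (@enum_rank I)) /=; last exact/onW_bij/enum_rank_bij.
  rewrite big_mkcond /=; apply: eq_bigr => i _; rewrite inE enum_rankK.
  by case: (k _ != 0); rewrite ?scale1r ?scale0r.
have [phi /(_ freeX)] := linear_of_free X [seq (b i : ('F_2)^o) | i <- enum I].
rewrite size_map -cardE size_tuple => /(_ erefl) phiX; exists phi => i.
have := congr1 (fun s => s`_(enum_rank i)) phiX.
rewrite (nth_map 0) ?size_tuple // -tnth_nth tnth_mktuple enum_rankK => ->.
by rewrite (nth_map i) -?cardE ?ltn_ord // nth_enum_rank.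
Qed.

Lemma expr_dim_lin_comb (K : fieldType) (L : fieldExtType K) (x : L) :
  exists c : nat -> K, x ^+ \dim {:L} = \sum_(j < \dim {:L}) c j *: x ^+ j.
Proof.
set m := \dim {:L}; pose p := minPoly 1 x * 'X^(m - adjoin_degree 1 x).
have le_m : (adjoin_degree 1 x <= m)%N.
  by rewrite adjoin_degreeE dimv1 divn1 dimvS ?subvf.
have size_p : size p = m.+1.
  rewrite size_monicM ?monic_minPoly ?monic_neq0 ?monicXn //.
  by rewrite size_minPoly size_polyXn addSn addnS subnKC.
have p_monic : p \is monic by rewrite monicMl ?monic_minPoly ?monicXn.
have p_x : p.[x] = 0 by rewrite hornerM minPolyxx mul0r.
have coef_p j : exists a : K, p`_j == a%:A.
  have /polyOverP/(_ j)/vlineP[a ->] : p \is a polyOver 1%VS; last by exists a.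
  by rewrite rpredM ?minPolyOver ?polyOverXn.
exists (fun j => - xchoose (coef_p j)).
move: p_monic p_x; rewrite monicE lead_coefE horner_coef size_p big_ord_recr /=.
move=> /eqP-> /eqP; rewrite mul1r addrC addr_eq0 => /eqP->; rewrite -sumrN.
by apply: eq_bigr => j _; rewrite scaleNr [in LHS](eqP (xchooseP (coef_p j))) mulr_algl.
Qed.

Lemma linear_form_recurrent (L : fieldExtType 'F_2) (phi : {linear L -> ('F_2)^o})
    (x y : L) :
  exists2 f, size f = \dim {:L} & recurrent f (fun t => phi (y * x ^+ t) != 0).
Proof.
have [c x_dim] := expr_dim_lin_comb x; set m := \dim {:L} in x_dim *.
exists (mkseq (fun j => c (m - j.+1)%N != 0) m); first by rewrite size_mkseq.
move=> t; rewrite size_mkseq => le_mt; rewrite /dot overlap_sum size_mkseq.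
rewrite -F2_natr_neq0 natr_sum -{1}(subnK le_mt) exprD x_dim !mulr_sumr linear_sum /=.
rewrite (reindex_inj rev_ord_inj) /=; congr (_ != 0); apply: eq_bigr => j _.
have lt_jt : (j < t)%N := leq_trans (ltn_ord j) le_mt.
rewrite -!scalerAr linearZ /= -exprD nth_mkseq // nth_rev size_mkseq //.
rewrite nth_mkseq; last by lia.
rewrite -mulnb natrM -!F2_natr; congr (_ * phi (y * x ^+ _)).
by have := ltn_ord j; lia.
Qed.

Lemma lfsr_universal n m (T A : {set 'I_n}) : (2 ^ #|T| * n < 2 ^ m)%N ->
  exists f w : bitseq, [/\ size f = m, size w = m
    & {in T, forall i : 'I_n, nth false (lfsr n w f) i = (i \in A)}].
Proof.
have [->|m_gt0] := posnP m => lt_m.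
  exists [::], [::]; split=> // i _; have n_gt0 := leq_ltn_trans (leq0n i) (ltn_ord i).
  by move: lt_m; rewrite expn0 ltnNge muln_gt0 expn_gt0 n_gt0.
have [F charF card_F] := pPrimePowerField (isT : prime 2) m_gt0.
pose L : fieldExtType 'F_2 := pPrimeCharType charF.
have dim_L : \dim {:L} = m by rewrite pprimeChar_dimf card_F pfactorK.
pose e (i : {i | i \in T}) := (n - val i)%N.
have inj_e : injective e.
  by move=> i j /eqP; rewrite eqn_sub2lE ?(ltnW (ltn_ord _)) // => /eqP/ord_inj/val_inj.
have [i||x sum_neq0] := exists_nonzero_power_sums (F := F) (d := n) inj_e.
- exact: leq_subr.
- by rewrite card_sig card_F.
pose z : L := x.
have [phi phi_x] := @exists_F2_linear_form L _ (fun i => z ^+ e i)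
  (fun i => (val i \in A)%:R) sum_neq0.
have [f size_f rec_f] := linear_form_recurrent phi z (z / z ^+ m).
rewrite dim_L in size_f; set r := fun t => _ in rec_f.
exists f, (rev (mkseq r m)); rewrite size_rev size_mkseq; split=> // i iT.
have lt_in := ltn_ord i.
rewrite lfsr_recurrent ?size_f // nth_rev size_mkseq ?nth_mkseq; try by lia.
have z_neq0 : z != 0.
  have := sum_neq0 [set Sub i iT]; rewrite big_set1 -cards_eq0 cards1 => /(_ isT).
  by rewrite expf_eq0 subn_gt0 lt_in.
have -> : (m + n - i.+1 = m + (n - i.+1))%N by lia.
rewrite /r exprD mulrA mulfVK ?expf_neq0 // -exprS subnSK // (phi_x (Sub i iT)).
by rewrite F2_natr_neq0 oddb.
Qed.

End FiniteFields.

(** * The auction *)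

Lemma count_pmap (S T : Type) (f : S -> option T) (P : pred T) (s : seq S) :
  count P (pmap f s) = count (fun x => oapp P false (f x)) s.
Proof. by elim: s => //= x s <-; case: (f x). Qed.

Lemma count_le_nth (T : Type) (x0 : T) (P : pred T) (s : seq T) (b : bitseq) :
  (forall u, u < size s -> P (nth x0 s u) -> nth false b u) ->
  count P s <= count id b.
Proof.
elim: s b => [|x s IH] b le_b //=.
have le_tail : count P s <= count id (behead b).
  by apply: IH => u lt_u Pu; rewrite nth_behead le_b.
have le_head : P x <= head false b by case Px: (P x); rewrite // -nth0 le_b.
by rewrite (leq_trans (leq_add le_head le_tail)) //; case: (b).
Qed.

(* A bid [Some a] is for one of the cells in [a], and [None] stands for no bid.  The
   level of a cell is what remains of its capacity, so a bid is placed on a cell of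
   maximal level and lowers it; the second component is the bid that holds the cell. *)
Local Notation cell := (nat * option bitseq)%type.
Local Notation level st u := (nth (0, None : option bitseq) st u).1.
Local Notation owner st u := (nth (0, None : option bitseq) st u).2.

Fixpoint max_level (a : bitseq) (st : seq cell) (best : nat) : nat :=
  match a, st with
  | x :: a', c :: st' =>
      max_level a' st' (if x && (best < c.1) then c.1 else best)
  | _, _ => best
  end.

Fixpoint place_bid (a : bitseq) (st : seq cell) (p : nat) (new : option bitseq) :
    option bitseq * seq cell :=
  match a, st with
  | x :: a', c :: st' =>
      if x && (p <= c.1) then (c.2, (c.1.-1, new) :: st')
      else let r := place_bid a' st' p new in (r.1, c :: r.2)
  | _, _ => (None, st)
  end.

Fixpoint bidding (fuel : nat) (W : seq (option bitseq)) (st : seq cell) : seq cell :=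
  if fuel is fuel'.+1 then
    match W with
    | [::] => st
    | None :: W' => bidding fuel' W' st
    | Some a :: W' =>
        let p := max_level a st 0 in
        if p == 0 then bidding fuel' W' st
        else let r := place_bid a st p (Some a) in bidding fuel' (r.1 :: W') r.2
    end
  else st.

Definition load (st : seq cell) : nat := sumn (map fst st).

Definition initial_cells (n : nat) : seq cell := nseq n (n.+1, None).

Definition auction (n : nat) (Q : seq (option bitseq)) : seq cell :=
  bidding (size Q + load (initial_cells n)).+1 Q (initial_cells n).

Definition below (st : seq cell) (i : nat) : bitseq := [seq c.1 < i | c <- st].

Lemma max_level_ge_best a st best : best <= max_level a st best.
Proof.
elim: a st best => [|x a IH] [|c st] best //=; apply: leq_trans (IH _ _).
by case: ifP => // /andP[_ /ltnW].
Qed.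

Lemma max_level_ge a st best u : nth false a u -> level st u <= max_level a st best.
Proof.
elim: a st best u => [|x a IH] [|c st] best [|u] //=; last exact: IH.
by move=> ->; apply: leq_trans (max_level_ge_best _ _ _); case: ltnP.
Qed.

Lemma max_level_attained a st best : best < max_level a st best ->
  exists u, [/\ u < size st, nth false a u & level st u = max_level a st best].
Proof.
elim: a st best => [|x a IH] [|c st] best //=; try by rewrite ltnn.
set b := if _ then _ else _.
have [/IH[u [lt_u a_u e]] _|le_b] := ltnP b (max_level a st b); first by exists u.+1.
have -> : max_level a st b = b by apply/anti_leq; rewrite le_b max_level_ge_best.
by rewrite /b; case: ifP => [/andP[x_true _] _|]; [exists 0 | rewrite ltnn].
Qed.

Lemma place_bid_ge a st p new u : u < size st -> nth false a u -> p <= level st u ->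
  exists v, [/\ v < size st, nth false a v, p <= level st v
    & place_bid a st p new
      = (owner st v, set_nth (0, None) st v ((level st v).-1, new))].
Proof.
elim: a st u => [|x a IH] [|c st] [|u] //=.
- by move=> _ -> le_p; exists 0; rewrite /= le_p.
- move=> lt_u a_u le_u; case: ifP => [/andP[x_true le_p]|_]; first by exists 0.
  by have [v [lt_v a_v le_v ->]] := IH st u lt_u a_u le_u; exists v.+1.
Qed.

Lemma place_bid_max a st new (p := max_level a st 0) : 0 < p ->
  exists v, [/\ v < size st, nth false a v, level st v = p
    & place_bid a st p new = (owner st v, set_nth (0, None) st v (p.-1, new))].
Proof.
move=> /max_level_attained[u [lt_u a_u e]].
have [v [lt_v a_v le_v ->]] := place_bid_ge new lt_u a_u (eq_leq (esym e)).
have e_v : level st v = p by apply/anti_leq; rewrite max_level_ge.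
by exists v; rewrite e_v.
Qed.

Lemma load_place_bid a st new (p := max_level a st 0) : 0 < p ->
  load (place_bid a st p new).2 < load st.
Proof.
move=> p_gt0; have [v [lt_v _ e_v ->]] := place_bid_max new p_gt0.
rewrite /load set_nthE lt_v -[in ltnRHS](cat_take_drop v st) (drop_nth (0, None) lt_v).
by rewrite !map_cat !sumn_cat /= e_v; lia.
Qed.

Lemma size_place_bid a st p new : size (place_bid a st p new).2 = size st.
Proof. by elim: a st => [|x a IH] [|c st] //=; case: ifP => //= _; rewrite IH. Qed.

Lemma size_bidding fuel W st : size (bidding fuel W st) = size st.
Proof.
elim: fuel W st => [|fuel IH] [|[a|] W] st //=.
by case: ifP; rewrite IH ?size_place_bid.
Qed.

Lemma size_auction n Q : size (auction n Q) = n.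
Proof. by rewrite size_bidding size_nseq. Qed.

Definition bid_fits (m : nat) (o : option bitseq) : bool :=
  if o is Some a then size a <= m else true.

Definition cell_fits (m : nat) (c : cell) : bool := (c.1 <= m) && bid_fits m c.2.

Lemma place_bid_fits m a st p new : bid_fits m new -> all (cell_fits m) st ->
  bid_fits m (place_bid a st p new).1 && all (cell_fits m) (place_bid a st p new).2.
Proof.
move=> fits_new; elim: a st => [|x a IH] [|[e o] st] //= /andP[fits_c fits_st].
case: ifP => _ /=; last by have /andP[-> ->] := IH st fits_st; rewrite fits_c.
have /andP[/= le_e ->] := fits_c.
by rewrite /cell_fits /= fits_new fits_st !andbT (leq_trans (leq_pred e)).
Qed.

Lemma bidding_fits m fuel W st : all (bid_fits m) W -> all (cell_fits m) st ->
  all (cell_fits m) (bidding fuel W st).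
Proof.
elim: fuel W st => [|fuel IH] [|[a|] W] st //=; last exact: IH.
move=> /andP[fits_a fits_W] fits_st; case: ifP => _; first exact: IH.
have /andP[fits_out fits_st'] :=
  place_bid_fits a (max_level a st 0) (fits_a : bid_fits m (Some a)) fits_st.
by apply: IH => //=; rewrite fits_out.
Qed.

Lemma initial_cells_fit n : all (cell_fits n.+1) (initial_cells n).
Proof. by rewrite all_nseq /cell_fits /= leqnn orbT. Qed.

Lemma auction_fits n Q : all (bid_fits n.+1) Q -> all (cell_fits n.+1) (auction n Q).
Proof. by move=> fits_Q; apply: bidding_fits => //; apply: initial_cells_fit. Qed.

Section Auction.
Variables (n : nat) (Q : seq (option bitseq)).
Implicit Types (st : seq cell) (W : seq (option bitseq)) (D : seq bitseq).

(* [W] holds the bids to be placed and [D] those that were dropped. *)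
Record auction_inv st W D : Prop := AuctionInv {
  inv_bids : perm_eq (pmap id Q) (pmap snd st ++ pmap id W ++ D);
  inv_owner : forall u a, owner st u = Some a -> nth false a u;
  inv_balanced : forall u a v, owner st u = Some a -> nth false a v ->
    level st v <= (level st u).+1;
  inv_unowned : forall u, u < n -> owner st u = None -> level st u = n.+1;
  inv_dropped : forall a u, a \in D -> nth false a u -> level st u = 0;
  inv_size : size st = n
}.

Lemma auction_inv_initial : auction_inv (initial_cells n) Q [::].
Proof.
have nth_init u : nth (0, None) (initial_cells n) u = (if u < n then n.+1 else 0, None).
  by rewrite nth_nseq; case: ifP.
split=> //.
- suff -> : pmap snd (initial_cells n) = [::] by rewrite cats0.
  by rewrite /initial_cells; elim: n (n.+1).
- by move=> u a; rewrite nth_init.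
- by move=> u a v; rewrite nth_init.
- by move=> u lt_u; rewrite nth_init lt_u.
- by rewrite size_nseq.
Qed.

Lemma auction_inv_bid st W D a (p := max_level a st 0)
    (r := place_bid a st p (Some a)) :
  0 < p -> auction_inv st (Some a :: W) D -> auction_inv r.2 (r.1 :: W) D.
Proof.
move=> p_gt0 [bids owned balanced unowned dropped size_st].
have [v [lt_v a_v e_v]] := place_bid_max (Some a) p_gt0; rewrite -/p -/r => -> /=.
set st' := set_nth _ _ _ _.
have levelE u : level st' u = if u == v then p.-1 else level st u.
  by rewrite nth_set_nth /=; case: eqP.
have ownerE u : owner st' u = if u == v then Some a else owner st u.
  by rewrite nth_set_nth /=; case: eqP.
have level_le u : level st' u <= level st u.
  by rewrite levelE; case: eqP => // ->; rewrite e_v leq_pred.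
split.
- apply/permP => P; rewrite (permP bids) /st' set_nthE lt_v.
  rewrite -{1}(cat_take_drop v st) (drop_nth (0, None) lt_v) !pmap_cat /= !count_cat.
  case: (nth _ st v) => e [b|]; rewrite /= ?count_cat; lia.
- by move=> u b; rewrite ownerE; case: eqP => [->[<-]|_ /owned].
- move=> u b w; rewrite ownerE [in X in _ <= X]levelE.
  case: eqP => [_ [<-] a_w|_ u_b b_w].
    by rewrite prednK // (leq_trans (level_le w)) ?max_level_ge.
  exact: leq_trans (level_le w) (balanced u b w u_b b_w).
- by move=> u lt_u; rewrite ownerE levelE; case: eqP => // _; apply: unowned.
- move=> b u bD b_u; apply/eqP; rewrite -leqn0 (leq_trans (level_le u)) //.
  by rewrite (dropped b).
by rewrite size_set_nth size_st; apply/maxn_idPr; rewrite -size_st.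
Qed.

Lemma auction_inv_drop st W D a : max_level a st 0 = 0 ->
  auction_inv st (Some a :: W) D -> auction_inv st W (a :: D).
Proof.
move=> max0 [bids owned balanced unowned dropped size_st]; split=> //.
  by apply/permP => P; rewrite (permP bids) !count_cat /=; lia.
move=> b u; rewrite inE => /predU1P[-> a_u|]; last exact: dropped.
by have := max_level_ge st 0 a_u; rewrite max0 leqn0 => /eqP.
Qed.

Lemma auction_inv_bidding fuel st W D :
  size W + load st < fuel -> auction_inv st W D ->
  exists D', auction_inv (bidding fuel W st) [::] D'.
Proof.
elim: fuel st W D => // fuel IH st [|[a|] W] D /= lt_fuel inv.
- by exists D.
- case: eqP => [max0|/eqP]; first by apply: IH (auction_inv_drop max0 inv); lia.
  rewrite -lt0n => p_gt0; apply: IH (auction_inv_bid p_gt0 inv).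
  by have := load_place_bid (Some a) p_gt0; rewrite /=; lia.
- by apply: (IH st W D) => //; case: inv; split.
Qed.

Lemma exists_vacant_level st : size st = n ->
  exists2 i, 0 < i <= n.+1 & i \notin map fst st.
Proof.
move=> size_st; have: ~~ all (mem (map fst st)) (iota 1 n.+1).
  apply/negP => /allP sub; have := uniq_leq_size (iota_uniq 1 n.+1) sub.
  by rewrite size_iota size_map size_st ltnn.
by rewrite -has_predC => /hasP[i]; rewrite mem_iota add1n ltnS; exists i.
Qed.

Lemma bits_sub_below st i a : size st = n -> size a <= n ->
  (forall u, nth false a u -> level st u < i) -> bits_sub a (below st i).
Proof.
move=> size_st size_a low; apply/bits_subP => u a_u.
rewrite (nth_map (0, None)) ?low // size_st; apply: leq_trans size_a.
by rewrite ltnNge; apply: contraL a_u => /(nth_default _)->.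
Qed.

Section Outcome.
Variables (st : seq cell) (D : seq bitseq).
Hypotheses (inv : auction_inv st [::] D) (fitsQ : all (bid_fits n) Q).

Lemma auctioned_fits a : a \in pmap snd st ++ D -> size a <= n.
Proof.
by rewrite -(perm_mem (inv_bids inv)) mem_pmap map_id => /(allP fitsQ).
Qed.

Lemma count_owners_le B : count (bits_sub^~ B) (pmap snd st) <= count id B.
Proof.
rewrite count_pmap; apply: (@count_le_nth _ (0, None)) => u _.
by case e: (owner st u) => [a|] //= /bits_subP; apply; apply: (inv_owner inv).
Qed.

(* A bid that holds a cell below a vacant level has all its cells at most one level
   higher, hence below the vacant level again. *)
Lemma count_below_le_owners i : i <= n.+1 -> i \notin map fst st ->
  count id (below st i) <= count (bits_sub^~ (below st i)) (pmap snd st).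
Proof.
move=> i_le vacant; rewrite count_pmap count_map.
set won := fun c : cell => oapp _ false c.2.
suff sub_won : {in st, forall c, c.1 < i -> won c}.
  rewrite -(@eq_in_count _ (predI (fun c : cell => c.1 < i) won)) ?sub_count //.
    by move=> c /andP[].
  by move=> c cst /=; apply/andb_idr/sub_won.
move=> c /(nthP (0, None))[u lt_u <-{c}] lt_i; rewrite /won.
case e: (owner st u) => [a|] /=; last first.
  have lt_un : u < n by rewrite -(inv_size inv).
  by rewrite ltnNge (inv_unowned inv lt_un e) i_le in lt_i.
apply: bits_sub_below (inv_size inv) _ _ => [|v a_v].
  by apply: auctioned_fits; rewrite mem_cat mem_pmap -e map_f ?mem_nth.
rewrite ltn_neqAle (leq_trans (inv_balanced inv e a_v)) // andbT.
have [lt_v|le_v] := ltnP v (size st).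
  by apply: contra vacant => /eqP<-; rewrite map_f ?mem_nth.
by rewrite nth_default // neq_ltn (leq_trans _ lt_i).
Qed.

Lemma hall_violator_dropped B :
  count id B < count (bits_sub^~ B) (pmap id Q) -> 0 < size D.
Proof.
rewrite (permP (inv_bids inv)) /= count_cat lt0n size_eq0.
by apply: contraTneq => ->; rewrite addn0 -leqNgt count_owners_le.
Qed.

(* There are [n] cells, so one of the levels [1 .. n+1] is vacant; the cells below it
   are outnumbered by their owners together with the dropped bids. *)
Lemma hall_violator_below B : count id B < count (bits_sub^~ B) (pmap id Q) ->
  exists2 i, 0 < i <= n.+1
    & count id (below st i) < count (bits_sub^~ (below st i)) (pmap id Q).
Proof.
move=> /hall_violator_dropped D_gt0.
have [i i_range vacant] := exists_vacant_level (inv_size inv); exists i => //.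
have /andP[i_gt0 i_le] := i_range.
rewrite (permP (inv_bids inv)) count_cat -addn1 leq_add ?count_below_le_owners //.
rewrite (leq_trans D_gt0) // eq_leq //; apply/esym/eqP; rewrite -all_count.
apply/allP => a aD; apply: bits_sub_below (inv_size inv) _ _ => [|u a_u].
  by apply: auctioned_fits; rewrite mem_cat aD orbT.
by rewrite (inv_dropped inv aD).
Qed.

End Outcome.
End Auction.

Lemma auction_hall n Q B : all (bid_fits n) Q ->
  count id B < count (bits_sub^~ B) (pmap id Q) ->
  exists2 i, 0 < i <= n.+1
    & count id (below (auction n Q) i)
      < count (bits_sub^~ (below (auction n Q) i)) (pmap id Q).
Proof.
move=> fitsQ.
have [D inv] := auction_inv_bidding (leqnn _) (auction_inv_initial n Q).
exact: (hall_violator_below inv).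
Qed.

(** * The algorithm on bit vectors *)

(* [green] and [low] say whether the vertex is green and of low degree; [g] and [gh]
   are the green vertices and the green vertices of high degree. *)
Definition survivor_bid (g gh S row : bitseq) (green low : bool) : option bitseq :=
  if green && (overlap row (if low then g else gh) == 0) then Some (bits_diff row S)
  else None.

Definition survivor_bids (g gh S : bitseq) (rows : seq bitseq) (greens lows : bitseq) :
    seq (option bitseq) :=
  [seq survivor_bid g gh S t.1 t.2.1 t.2.2 | t <- zip rows (zip greens lows)].

Definition exchange_bit (B : bitseq) (x : bool) (o : option bitseq) (y : bool) : bool :=
  if x then (if o is Some row then ~~ bits_sub row B else true) else y.

Definition exchange_bits (B S : bitseq) (Q : seq (option bitseq)) (ys : bitseq) :
    bitseq :=
  [seq exchange_bit B t.1 t.2.1 t.2.2 | t <- zip S (zip Q ys)].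

Fixpoint try_levels (i : nat) (S : bitseq) (Q : seq (option bitseq)) (st : seq cell) :
    option bitseq :=
  if i is i'.+1 then
    let B := below st i in
    let T := exchange_bits B S Q B in
    if count id T < count id S then Some T else try_levels i' S Q st
  else None.

Definition low_bits (beta : nat) (rows : seq bitseq) : bitseq :=
  [seq count id r < beta.+1 | r <- rows].

Definition green_bits (S f w : bitseq) : bitseq := bits_diff S (lfsr (size S) w f).

Definition try_colouring (beta : nat) (rows : seq bitseq) (S f w : bitseq) :
    option bitseq :=
  let g := green_bits S f w in
  let low := low_bits beta rows in
  let Q := survivor_bids g (bits_diff g low) S rows g low in
  try_levels (size S).+1 S Q (auction (size S) Q).

Definition orelse (T : Type) (o1 o2 : option T) : option T :=
  if o1 is Some _ then o1 else o2.

Fixpoint search_seeds (T : Type) (test : bitseq -> bitseq -> option T) (m : nat)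
    (f w : bitseq) : option T :=
  if m is m'.+1 then
    let next x y := search_seeds test m' (x :: f) (y :: w) in
    orelse (next false false) (orelse (next false true)
      (orelse (next true false) (next true true)))
  else test f w.

Definition seed_length (beta k n : nat) : nat :=
  beta.+1 * uphalf k + up_log 2 n.+1.

Lemma try_levels_some i S Q st T : try_levels i S Q st = Some T ->
  count id T < count id S /\
  exists j, T = exchange_bits (below st j) S Q (below st j).
Proof.
by elim: i => //= i IH; case: ifP => // lt_T [<-]; split=> //; exists i.+1.
Qed.

Lemma try_levels_isSome k i S Q st : 0 < i <= k ->
  count id (exchange_bits (below st i) S Q (below st i)) < count id S ->
  try_levels k S Q st.
Proof.
elim: k => [|k IH] /andP[i_gt0]; first by rewrite leqNgt i_gt0.
rewrite leq_eqVlt => /predU1P[ei|lt_ik] lt_S /=; first by rewrite -ei lt_S.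
by case: ifP => // _; apply: IH => //; rewrite i_gt0.
Qed.

Section SearchSeeds.
Variables (T : Type) (test : bitseq -> bitseq -> option T).

Lemma search_seeds_some m f w x :
  search_seeds test m f w = Some x -> exists f' w', test f' w' = Some x.
Proof.
have orelse_some (o1 o2 : option T) :
    orelse o1 o2 = Some x -> o1 = Some x \/ o2 = Some x.
  by case: o1; [left | right].
elim: m f w => [|m IH] f w /=; first by exists f, w.
by do 3!(case/orelse_some; first exact: IH); apply: IH.
Qed.

Lemma search_seeds_isSome f' w' f w : size f' = size w' ->
  test (catrev f' f) (catrev w' w) -> search_seeds test (size f') f w.
Proof.
elim: f' w' f w => [|x f' IH] [|y w'] //= f w [eq_size] /(IH _ _ _ eq_size) found.
have orelseE (o1 o2 : option T) : orelse o1 o2 = o1 || o2 :> bool by case: o1.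
by rewrite !orelseE; case: x y found => [] [] ->; rewrite ?orbT.
Qed.

End SearchSeeds.

(** * Sets of vertices as bit vectors *)

Lemma count_enum (T : finType) (P : pred T) : count P (enum T) = #|P|.
Proof. by rewrite -sum1_count big_enum_cond -sum1_card; apply: eq_bigl. Qed.

Section SetBits.
Variable n : nat.
Implicit Types A B : {set 'I_n}.

Definition set_bits A : bitseq := [seq i \in A | i <- enum 'I_n].

Lemma size_set_bits A : size (set_bits A) = n.
Proof. by rewrite size_map size_enum_ord. Qed.

Lemma nth_set_bits A (i : 'I_n) : nth false (set_bits A) i = (i \in A).
Proof. by rewrite (nth_map i) ?size_enum_ord // nth_ord_enum. Qed.

Lemma count_set_bits A : count id (set_bits A) = #|A|.
Proof. by rewrite count_map count_enum. Qed.

Lemma set_bitsP (b : bitseq) : size b = n -> {A | b = set_bits A}.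
Proof.
move=> size_b; exists [set i : 'I_n | nth false b i].
apply: (@eq_from_nth _ false) => [|i]; rewrite size_b ?size_set_bits // => lt_i.
by rewrite (nth_set_bits _ (Ordinal lt_i)) inE.
Qed.

Lemma bits_diff_set_bits A B : bits_diff (set_bits A) (set_bits B) = set_bits (A :\: B).
Proof.
apply: (@eq_from_nth _ false) => [|i]; rewrite size_bits_diff !size_set_bits // => lt_i.
by rewrite nth_bits_diff !(nth_set_bits _ (Ordinal lt_i)) inE andbC.
Qed.

Lemma bits_sub_set_bits A B : bits_sub (set_bits A) (set_bits B) = (A \subset B).
Proof. by rewrite /bits_sub bits_diff_set_bits count_set_bits cards_eq0 setD_eq0. Qed.

Lemma overlap_set_bits A B : overlap (set_bits A) (set_bits B) = #|A :&: B|.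
Proof. by rewrite /overlap !bits_diff_set_bits count_set_bits setDDr setDv set0U. Qed.

End SetBits.

(** * Correctness of the algorithm *)

Section Correctness.
Variables (n : nat) (G : sgraph 'I_n) (beta : nat) (S : {set 'I_n}).
Implicit Types A B I W : {set 'I_n}.

Definition adj_rows : seq bitseq := [seq set_bits (neighbors G i) | i <- enum 'I_n].

Definition vertex_bids I : seq (option bitseq) :=
  [seq if i \in I then Some (set_bits (neighbors G i :\: S)) else None
  | i <- enum 'I_n].

Lemma low_bits_adj_rows : low_bits beta adj_rows = set_bits (low_degree G beta).
Proof.
by rewrite /low_bits -map_comp; apply: eq_map => i; rewrite /= count_set_bits inE.
Qed.

Lemma survivor_bids_set_bits W (low := low_degree G beta) :
  survivor_bids (set_bits W) (set_bits (W :\: low)) (set_bits S) adj_rows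
    (set_bits W) (set_bits low)
  = vertex_bids (survivors G beta W).
Proof.
rewrite /survivor_bids !zip_map -map_comp; apply: eq_map => i /=.
rewrite /survivor_bid bits_diff_set_bits [i \in survivors G beta W]inE /conflicts -/low.
case: (i \in low); rewrite overlap_set_bits cards_eq0 setI_eq0 //.
by rewrite -!setI_eq0 setIDA setIDAC.
Qed.

Lemma exchange_bits_set_bits I B :
  exchange_bits (set_bits B) (set_bits S) (vertex_bids I) (set_bits B)
  = set_bits (exchange G I S B).
Proof.
rewrite /exchange_bits !zip_map -map_comp; apply: eq_map => i /=.
rewrite /exchange_bit !inE; case: (i \in S); case: (i \in I);
  by rewrite ?bits_sub_set_bits ?andbT ?andbF ?orbF.
Qed.

Lemma count_vertex_bids I B :
  count (bits_sub^~ (set_bits B)) (pmap id (vertex_bids I)) = #|freed G I S B|.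
Proof.
rewrite count_pmap count_map count_enum; apply: eq_card => i; rewrite !inE /=.
by case: (i \in I) => //=; rewrite bits_sub_set_bits.
Qed.

Lemma vertex_bids_fit I : all (bid_fits n) (vertex_bids I).
Proof.
by rewrite all_map; apply/allP => i _ /=; case: ifP => //= _; rewrite size_set_bits.
Qed.

Definition green_set f w : {set 'I_n} :=
  S :\: [set i : 'I_n | nth false (lfsr n w f) i].

Lemma green_bits_set_bits f w : green_bits (set_bits S) f w = set_bits (green_set f w).
Proof.
rewrite /green_bits size_set_bits.
apply: (@eq_from_nth _ false) => [|i]; rewrite size_bits_diff !size_set_bits // => lt_i.
by rewrite nth_bits_diff !(nth_set_bits _ (Ordinal lt_i)) !inE andbC.
Qed.

Lemma try_colouringE f w (Q := vertex_bids (survivors G beta (green_set f w))) :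
  try_colouring beta adj_rows (set_bits S) f w
  = try_levels n.+1 (set_bits S) Q (auction n Q).
Proof.
rewrite /try_colouring green_bits_set_bits low_bits_adj_rows bits_diff_set_bits.
by rewrite survivor_bids_set_bits size_set_bits.
Qed.

Lemma try_colouring_some f w T : vertex_cover G S ->
  try_colouring beta adj_rows (set_bits S) f w = Some T ->
  exists S' : {set 'I_n}, [/\ T = set_bits S', vertex_cover G S' & #|S'| < #|S|].
Proof.
move=> coverS; rewrite try_colouringE; set Q := vertex_bids _.
move=> /try_levels_some[lt_T [j defT]].
have [B defB] : {B : {set 'I_n} | below (auction n Q) j = set_bits B}.
  by apply: set_bitsP; rewrite size_map size_auction.
rewrite defB exchange_bits_set_bits in defT.
exists (exchange G (survivors G beta (green_set f w)) S B); split=> //.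
  by apply: vertex_cover_exchange => //; apply: survivors_independent.
by rewrite -!count_set_bits -defT.
Qed.

Lemma try_colouring_isSome f w A :
  A \subset survivors G beta (green_set f w) -> #|neighborhood G A :\: S| < #|A| ->
  try_colouring beta adj_rows (set_bits S) f w.
Proof.
set I := survivors _ _ _ => sub_AI lt_A; rewrite try_colouringE -/I.
have sub_IS : I \subset S := subset_trans (survivors_sub _ _ _) (subsetDl _ _).
have [|i i_range lt_i] :=
    auction_hall (vertex_bids_fit I) (B := set_bits (neighborhood G A :\: S)).
  rewrite count_set_bits count_vertex_bids (leq_trans lt_A) // subset_leq_card //.
  by apply/subsetP => v vA; rewrite inE (subsetP sub_AI) // setSD // bigcup_sup.
apply: try_levels_isSome i_range _.
have [B defB] : {B : {set 'I_n} | below (auction n (vertex_bids I)) i = set_bits B}.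
  by apply: set_bitsP; rewrite size_map size_auction.
rewrite defB exchange_bits_set_bits !count_set_bits count_vertex_bids in lt_i *.
by have := card_exchange G B sub_IS; lia.
Qed.

(* The colours that matter are those of [A] and of its conflicts. *)
Lemma search_seeds_improving k (S' : {set 'I_n}) : separable G beta ->
  vertex_cover G S' -> #|S'| < #|S| -> dist S S' <= k ->
  search_seeds (try_colouring beta adj_rows (set_bits S)) (seed_length beta k n)
    [::] [::].
Proof.
move=> sep cover' lt_S' le_k.
have [A [sub_AS indepA lt_A le_A]] := improving_subset cover' lt_S' le_k.
pose R := \bigcup_(v in A) conflicts G beta v.
have lt_m : 2 ^ #|A :|: R| * n < 2 ^ seed_length beta k n.
  rewrite expnD; apply: leq_ltn_trans (_ : 2 ^ (beta.+1 * uphalf k) * n < _).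
    rewrite leq_mul2r leq_exp2l // (leq_trans (card_bigcup_conflicts _ sep)) ?orbT //.
    by rewrite leq_mul2l le_A orbT.
  by rewrite ltn_mul2l expn_gt0 up_logP.
have [f [w [size_f size_w colour]]] := lfsr_universal R lt_m.
rewrite -size_f -size_rev; apply: (@search_seeds_isSome _ _ _ (rev w)).
  by rewrite !size_rev size_f.
rewrite !catrevE !cats0 !revK.
have /pred0P disjAR := independent_disjoint_conflicts beta indepA.
apply: try_colouring_isSome lt_A; apply: sub_survivors.
  apply/subsetP => v vA; rewrite !inE (subsetP sub_AS) // colour ?inE ?vA //.
  by have := disjAR v; rewrite /= vA /= => ->.
apply/pred0P => v /=; apply/negP => /andP[vR].
by rewrite !inE colour ?inE ?vR ?orbT.
Qed.

End Correctness.

(** * Evaluation within a time bound *)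

Definition eval_within (p : program) (s : seq tree) (e : expr) (v : tree) (T : nat) :
    Prop :=
  exists2 t, eval p s e v t & t <= T.

Section EvalWithin.
Variable p : program.
Implicit Types (s : seq tree) (a b c e : expr) (u v x y : tree) (T : nat).

Lemma eval_within_le s e v T T' :
  eval_within p s e v T -> T <= T' -> eval_within p s e v T'.
Proof. by move=> [t ev le_tT] le_TT'; exists t => //; apply: leq_trans le_TT'. Qed.

Lemma eval_within_var s i v : nth Leaf s i = v -> eval_within p s (Var i) v 1.
Proof. by move=> <-; exists 1 => //; constructor. Qed.

Lemma eval_within_leaf s : eval_within p s Lf Leaf 1.
Proof. by exists 1 => //; constructor. Qed.

Lemma eval_within_node s a b u v T1 T2 :
  eval_within p s a u T1 -> eval_within p s b v T2 ->
  eval_within p s (Nd a b) (Node u v) (T1 + T2).+1.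
Proof.
move=> [t1 ev1 le1] [t2 ev2 le2]; exists (t1 + t2).+1; last by rewrite ltnS leq_add.
exact: EvNd.
Qed.

Lemma eval_within_let s a b u v T1 T2 :
  eval_within p s a u T1 -> eval_within p (u :: s) b v T2 ->
  eval_within p s (Let a b) v (T1 + T2).+1.
Proof.
move=> [t1 ev1 le1] [t2 ev2 le2]; exists (t1 + t2).+1; last by rewrite ltnS leq_add.
exact: EvLet ev1 ev2.
Qed.

Lemma eval_within_case s a b c u v T1 T2 :
  eval_within p s a u T1 ->
  (if u is Node x y then eval_within p [:: x, y & s] c v T2
   else eval_within p s b v T2) ->
  eval_within p s (Case a b c) v (T1 + T2).+1.
Proof.
case: u => [|x y] [t1 ev1 le1] [t2 ev2 le2];
  exists (t1 + t2).+1; rewrite ?ltnS ?leq_add //.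
  exact: EvCaseLf.
exact: EvCaseNd ev1 ev2.
Qed.

Lemma eval_within_call s i a u v T1 T2 :
  eval_within p s a u T1 -> eval_within p [:: u] (nth Lf p i) v T2 ->
  eval_within p s (Call i a) v (T1 + T2).+1.
Proof.
move=> [t1 ev1 le1] [t2 ev2 le2]; exists (t1 + t2).+1; last by rewrite ltnS leq_add.
exact: EvCall ev1 ev2.
Qed.

Lemma eval_within_succs s m e k T : eval_within p s e (nat_tree k) T ->
  eval_within p s (iter m (Nd Lf) e) (nat_tree (m + k)) (2 * m + T).
Proof.
move=> ev_e; elim: m => [|m IH] //=.
by apply: eval_within_le; [exact: eval_within_node (eval_within_leaf _) IH | lia].
Qed.

Lemma eval_within_numeral s m :
  eval_within p s (iter m (Nd Lf) Lf) (nat_tree m) (2 * m + 1).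
Proof.
rewrite -{2}[m]addn0; exact: (@eval_within_succs _ _ _ 0 1 (eval_within_leaf _)).
Qed.

End EvalWithin.

(** * Programs with named variables *)

(* An expression as a function of the length of the environment.  A variable is
   represented by the length of the environment at its binder, so that binders of the
   programs below are binders of Rocq. *)
Definition nexpr := nat -> expr.

Definition var (l : nat) : nexpr := fun d => Var (d - l.+1).
Definition leaf : nexpr := fun=> Lf.
Definition node (a b : nexpr) : nexpr := fun d => Nd (a d) (b d).
Definition yes : nexpr := node leaf leaf.
Definition succs (m : nat) (a : nexpr) : nexpr := fun d => iter m (Nd Lf) (a d).
Definition bind (a : nexpr) (b : nexpr -> nexpr) : nexpr :=
  fun d => Let (a d) (b (var d) d.+1).
Definition branch (a b : nexpr) (c : nexpr -> nexpr -> nexpr) : nexpr :=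
  fun d => Case (a d) (b d) (c (var d.+1) (var d) d.+2).

Declare Scope nexpr_scope.
Delimit Scope nexpr_scope with nexpr.
Bind Scope nexpr_scope with nexpr.

Notation "'Bind' x ':=' a 'in' b" := (bind a (fun x => b))
  (at level 200, x name, a at level 100, b at level 200) : nexpr_scope.
Notation "'If' a 'is' x '::' y 'then' c 'else' b" := (branch a b (fun x y => c))
  (at level 200, x name, y name, a at level 100, b at level 200, c at level 100)
  : nexpr_scope.
Notation "'If' a 'then' c 'else' b" := (branch a b (fun _ _ => c))
  (at level 200, a at level 100, b at level 200, c at level 100) : nexpr_scope.

Local Open Scope nexpr_scope.

Definition or_else (a b : nexpr) : nexpr := If a is x :: y then node x y else b.

(* Functions of several arguments take a right-nested tuple. *)
Definition call1 (F : nat) (a : nexpr) : nexpr := fun d => Call F (a d).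
Definition call2 F (a b : nexpr) : nexpr := call1 F (node a b).
Definition call3 F (a b c : nexpr) : nexpr := call2 F a (node b c).
Definition call4 F (a b c d : nexpr) : nexpr := call3 F a b (node c d).

Definition fun1 (body : nexpr -> nexpr) : expr := body (var 0) 1.
Definition fun2 (body : nexpr -> nexpr -> nexpr) : expr :=
  fun1 (fun ab => If ab is a :: b then body a b else leaf).
Definition fun3 (body : nexpr -> nexpr -> nexpr -> nexpr) : expr :=
  fun2 (fun a bc => If bc is b :: c then body a b c else leaf).
Definition fun4 (body : nexpr -> nexpr -> nexpr -> nexpr -> nexpr) : expr :=
  fun3 (fun a b cd => If cd is c :: d then body a b c d else leaf).
Definition fun6
    (body : nexpr -> nexpr -> nexpr -> nexpr -> nexpr -> nexpr -> nexpr) : expr :=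
  fun4 (fun a b c def => If def is d :: ef then
    If ef is e :: f then body a b c d e f else leaf else leaf).

Definition computes (p : program) (F : nat) (u v : tree) (T : nat) : Prop :=
  eval_within p [:: u] (nth Lf p F) v T.

Lemma eval_within_computes p s F a u v T1 T2 :
  eval_within p s a u T1 -> computes p F u v T2 ->
  eval_within p s (Call F a) v (T1 + T2).+1.
Proof. exact: eval_within_call. Qed.

(* Replaces a call by the body of the function and leaves the running time open. *)
Ltac enter_body :=
  lazymatch goal with |- computes ?p ?F _ _ _ =>
    let e := eval cbv -[iter] in (nth Lf p F) in
    change (computes p F) with (fun u => eval_within p [:: u] e); cbv beta
  end; apply: eval_within_le.

Ltac rewrite_known := repeat match goal with
  | H : ?b = true |- context [?b] => rewrite H
  | H : ?b = false |- context [?b] => rewrite H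
  | H : ?m = 0 |- context [?m] => rewrite H
  | H : ?m = _.+1 |- context [?m] => rewrite H
  end.

Ltac reduce_scrutinee :=
  lazymatch goal with
  | |- match ?u with Leaf => _ | Node x y => _ end =>
    let u' := eval hnf in u in change u with u'; cbv iota beta
  end.

(* Symbolic execution: the time bound is an evar that collects the cost of the path
   taken, and [calls] supplies the specification of a called function. *)
Ltac execute calls :=
  lazymatch goal with
  | |- eval_within _ _ (Var _) _ _ => eapply eval_within_var; cbn [nth]; reflexivity
  | |- eval_within _ _ Lf _ _ => apply eval_within_leaf
  | |- eval_within _ _ (Nd _ _) _ _ => eapply eval_within_node; execute calls
  | |- eval_within _ _ (Let _ _) _ _ =>
      eapply eval_within_let; [execute calls | execute calls]
  | |- eval_within _ _ (Case _ _ _) _ _ =>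
      eapply eval_within_case;
      [execute calls | rewrite_known; reduce_scrutinee; execute calls]
  | |- eval_within _ _ (Call _ _) _ _ =>
      eapply eval_within_computes; [execute calls | calls]
  | |- eval_within _ _ (iter _ _ Lf) _ _ => apply eval_within_numeral
  | |- eval_within _ _ (iter _ _ _) _ _ => eapply eval_within_succs; execute calls
  end.

Ltac run calls := enter_body; [execute calls | rewrite /=; lia].

Ltac run_nocall := run ltac:(fail).

(** * The program *)

Local Notation "[ 'args' a , .. , b & c ]" := (Node a .. (Node b c) ..)
  (format "[ 'args'  a ,  .. ,  b  &  c ]").

Definition bits_tree (l : bitseq) : tree := list_tree (map bool_tree l).

Definition rows_tree (rows : seq bitseq) : tree := list_tree (map bits_tree rows).

Definition bid_tree (o : option bitseq) : tree :=
  if o is Some row then Node Leaf (bits_tree row) else Leaf.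

Definition bids_tree (Q : seq (option bitseq)) : tree := list_tree (map bid_tree Q).

Definition cell_tree (c : cell) : tree := Node (nat_tree c.1) (bid_tree c.2).

Definition cells_tree (st : seq cell) : tree := list_tree (map cell_tree st).

(* Positions of the functions in the program. *)
Local Notation MAIN := 0.
Local Notation SEARCH := 1.
Local Notation TRY_COLOURING := 2.
Local Notation LFSR := 3.
Local Notation PARITY := 4.
Local Notation SIZE := 5.
Local Notation COUNT := 6.
Local Notation DIFF := 7.
Local Notation OVERLAP := 8.
Local Notation LESS := 9.
Local Notation LOWS := 10.
Local Notation BIDS := 11.
Local Notation BID := 12.
Local Notation INITIAL := 13.
Local Notation MAX_LEVEL := 14.
Local Notation PLACE_BID := 15.
Local Notation BIDDING := 16.
Local Notation BELOW := 17.
Local Notation EXCHANGE := 18.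
Local Notation EXCHANGE_BIT := 19.
Local Notation TRY_LEVELS := 20.
Local Notation HALF := 21.
Local Notation LOG := 22.
Local Notation SEED_LENGTH := 23.

Section Program.
Variable beta : nat.

Definition main_body : expr := fun4 (fun rows S k _ =>
  call4 SEARCH (call2 SEED_LENGTH k (call1 LOG (call1 SIZE S))) leaf leaf
    (node rows S)).

Definition search_body : expr := fun4 (fun m f w graph =>
  If m is _ :: m' then
    let next x y := call4 SEARCH m' (node x f) (node y w) graph in
    or_else (next leaf leaf) (or_else (next leaf yes)
      (or_else (next yes leaf) (next yes yes)))
  else call3 TRY_COLOURING f w graph).

Definition try_colouring_body : expr := fun4 (fun f w rows S =>
  Bind g := call2 DIFF S (call3 LFSR S w f) in
  Bind low := call1 LOWS rows in
  Bind Q := call4 BIDS rows g low (node g (node (call2 DIFF g low) S)) in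
  Bind top := node leaf (call1 SIZE S) in
  call4 TRY_LEVELS top S Q (call2 BIDDING Q (call2 INITIAL S top))).

Definition lfsr_body : expr := fun3 (fun l w f =>
  If l is _ :: l' then
    call3 LFSR l' (node (call1 PARITY (call2 OVERLAP f w)) w) f
  else w).

Definition parity_body : expr := fun1 (fun m =>
  If m is _ :: m' then If call1 PARITY m' then leaf else yes else leaf).

Definition size_body : expr := fun1 (fun l =>
  If l is _ :: l' then node leaf (call1 SIZE l') else leaf).

Definition count_body : expr := fun1 (fun l =>
  If l is x :: l' then
    If x then node leaf (call1 COUNT l') else call1 COUNT l'
  else leaf).

Definition diff_body : expr := fun2 (fun a b =>
  If a is x :: a' then
    If b is y :: b' then node (If y then leaf else x) (call2 DIFF a' b') else a
  else leaf).

Definition overlap_body : expr := fun2 (fun a b =>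
  call1 COUNT (call2 DIFF a (call2 DIFF a b))).

Definition less_body : expr := fun2 (fun m n =>
  If n is _ :: n' then If m is _ :: m' then call2 LESS m' n' else yes else leaf).

Definition lows_body : expr := fun1 (fun rows =>
  If rows is r :: rows' then
    node (call2 LESS (call1 COUNT r) (succs beta.+1 leaf)) (call1 LOWS rows')
  else leaf).

Definition bids_body : expr := fun4 (fun rows greens lows context =>
  If rows is r :: rows' then If greens is x :: greens' then If lows is y :: lows' then
    node (call4 BID x y r context) (call4 BIDS rows' greens' lows' context)
  else leaf else leaf else leaf).

Definition bid_body : expr := fun6 (fun green low row g gh S =>
  If green then
    If call2 OVERLAP row (If low then g else gh) then leaf
    else node leaf (call2 DIFF row S)
  else leaf).

Definition initial_body : expr := fun2 (fun l top =>
  If l is _ :: l' then node (node top leaf) (call2 INITIAL l' top) else leaf).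

Definition max_level_body : expr := fun3 (fun a st best =>
  If a is x :: a' then If st is c :: st' then If c is e :: _ then
    If x then call3 MAX_LEVEL a' st' (If call2 LESS best e then e else best)
    else call3 MAX_LEVEL a' st' best
  else leaf else best else best).

Definition place_bid_body : expr := fun4 (fun a st p new =>
  If a is x :: a' then If st is c :: st' then If c is e :: o then
    let skip := If call4 PLACE_BID a' st' p new is o' :: st'' then node o' (node c st'')
                else leaf in
    If x then
      If call2 LESS e p then skip
      else node o (node (node (If e is _ :: e' then e' else leaf) new) st')
    else skip
  else leaf else yes else node leaf st).

Definition bidding_body : expr := fun2 (fun W st =>
  If W is o :: W' then If o is _ :: a then
    Bind p := call3 MAX_LEVEL a st leaf in
    If p then
      If call4 PLACE_BID a st p o is o' :: st' then call2 BIDDING (node o' W') st'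
      else leaf
    else call2 BIDDING W' st
  else call2 BIDDING W' st else st).

Definition below_body : expr := fun2 (fun st i =>
  If st is c :: st' then If c is e :: _ then
    node (call2 LESS e i) (call2 BELOW st' i)
  else leaf else leaf).

Definition exchange_body : expr := fun4 (fun S Q ys B =>
  If S is x :: S' then If Q is o :: Q' then If ys is y :: ys' then
    node (call4 EXCHANGE_BIT x o y B) (call4 EXCHANGE S' Q' ys' B)
  else leaf else leaf else leaf).

Definition exchange_bit_body : expr := fun4 (fun x o y B =>
  If x then
    If o is _ :: row then If call1 COUNT (call2 DIFF row B) then yes else leaf else yes
  else y).

Definition try_levels_body : expr := fun4 (fun i S Q st =>
  If i is _ :: i' then
    Bind B := call2 BELOW st i in
    Bind T := call4 EXCHANGE S Q B B in
    If call2 LESS (call1 COUNT T) (call1 COUNT S) then node leaf T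
    else call4 TRY_LEVELS i' S Q st
  else leaf).

Definition half_body : expr := fun1 (fun m =>
  If m is _ :: m' then If m' is _ :: m'' then node leaf (call1 HALF m'') else leaf
  else leaf).

Definition log_body : expr := fun1 (fun m =>
  If m then node leaf (call1 LOG (call1 HALF m)) else leaf).

Definition seed_length_body : expr := fun2 (fun k l =>
  If k is _ :: k' then
    If k' is _ :: k'' then succs beta.+1 (call2 SEED_LENGTH k'' l) else succs beta.+1 l
  else l).

Definition pls_program : program :=
  [:: main_body; search_body; try_colouring_body; lfsr_body; parity_body; size_body;
      count_body; diff_body; overlap_body; less_body; lows_body; bids_body; bid_body;
      initial_body; max_level_body; place_bid_body; bidding_body; below_body;
      exchange_body; exchange_bit_body; try_levels_body; half_body; log_body;
      seed_length_body].

Local Notation prog := pls_program.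

Lemma computes_less m n :
  computes prog LESS [args nat_tree m & nat_tree n] (bool_tree (m < n)) (20 * m.+1).
Proof. by elim: m n => [|m IH] [|n]; run ltac:(eapply IH). Qed.

Lemma computes_parity m :
  computes prog PARITY (nat_tree m) (bool_tree (odd m)) (20 * m.+1).
Proof.
elim: m => [|m IH]; first by run_nocall.
by rewrite /=; case odd_m: (odd m) IH => IH; run ltac:(eapply IH).
Qed.

Lemma computes_size (l : bitseq) :
  computes prog SIZE (bits_tree l) (nat_tree (size l)) (20 * (size l).+1).
Proof. by elim: l => [|x l IH]; run ltac:(eapply IH). Qed.

Lemma computes_count l :
  computes prog COUNT (bits_tree l) (nat_tree (count id l)) (20 * (size l).+1).
Proof. by elim: l => [|[] l IH]; run ltac:(eapply IH). Qed.

Lemma computes_diff a b :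
  computes prog DIFF [args bits_tree a & bits_tree b] (bits_tree (bits_diff a b))
    (20 * (size a).+1).
Proof. by elim: a b => [|[] a IH] [|[] b]; run ltac:(eapply IH). Qed.

Lemma computes_overlap a b :
  computes prog OVERLAP [args bits_tree a & bits_tree b] (nat_tree (overlap a b))
    (100 * (size a).+1).
Proof.
enter_body.
  by execute ltac:(first [eapply computes_diff | eapply computes_count]).
by rewrite size_bits_diff; lia.
Qed.

Lemma computes_lfsr (l w f : bitseq) :
  computes prog LFSR [args bits_tree l, bits_tree w & bits_tree f]
    (bits_tree (lfsr (size l) w f)) ((size l).+1 * (200 * (size f).+1)).
Proof.
elim: l w => [|x l IH] w; first by run_nocall.
have le_overlap := overlap_le_size f w.
by run ltac:(first [eapply (IH (_ :: _)) | eapply computes_overlap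
  | eapply computes_parity]).
Qed.

Lemma computes_lows m rows : all (fun r => size r <= m) rows ->
  computes prog LOWS (rows_tree rows) (bits_tree (low_bits beta rows))
    ((size rows).+1 * (100 * (m + beta).+1)).
Proof.
elim: rows => [|r rows IH] /=; first by move=> _; run_nocall.
move=> /andP[le_r /IH{}IH]; have count_r := count_size id r.
by run ltac:(first [eapply computes_less | eapply computes_count | eapply IH]).
Qed.

Lemma computes_bid g gh S row green low :
  computes prog BID
    [args bool_tree green, bool_tree low, bits_tree row, bits_tree g, bits_tree gh
     & bits_tree S]
    (bid_tree (survivor_bid g gh S row green low)) (200 * (size row).+1).
Proof.
rewrite /survivor_bid; case: green; last by run_nocall.
by case: low => /=; case meet_row: (overlap _ _) => [|m];
  run ltac:(first [eapply computes_overlap | eapply computes_diff]).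
Qed.

Lemma computes_bids m g gh S rows greens lows : all (fun r => size r <= m) rows ->
  computes prog BIDS
    [args rows_tree rows, bits_tree greens, bits_tree lows, bits_tree g, bits_tree gh
     & bits_tree S]
    (bids_tree (survivor_bids g gh S rows greens lows)) ((size rows).+1 * (300 * m.+1)).
Proof.
elim: rows greens lows => [|r rows IH] [|x greens] [|y lows] //= fits;
  try by run_nocall.
by case/andP: fits => le_r /IH{}IH; run ltac:(first [eapply computes_bid | eapply IH]).
Qed.

Lemma computes_initial (l : bitseq) m :
  computes prog INITIAL [args bits_tree l & nat_tree m]
    (cells_tree (nseq (size l) (m, None))) (20 * (size l).+1).
Proof. by elim: l => [|x l IH]; run ltac:(eapply IH). Qed.

Lemma computes_max_level m a st best : best <= m -> all (cell_fits m) st ->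
  computes prog MAX_LEVEL [args bits_tree a, cells_tree st & nat_tree best]
    (nat_tree (max_level a st best)) ((size a).+1 * (60 * m.+1)).
Proof.
elim: a st best => [|x a IH] [|[e o] st] best le_best; try by move=> _; run_nocall.
rewrite [all _ _]/= => /andP[/andP[/= le_e _] fits].
case: x => /=; last by run ltac:(eapply (IH _ _ le_best fits)).
case lt_e: (best < e).
  by run ltac:(first [eapply computes_less | eapply (IH _ _ le_e fits)]).
by run ltac:(first [eapply computes_less | eapply (IH _ _ le_best fits)]).
Qed.

Lemma computes_place_bid m a st p new : all (cell_fits m) st ->
  computes prog PLACE_BID
    [args bits_tree a, cells_tree st, nat_tree p & bid_tree new]
    [args bid_tree (place_bid a st p new).1 & cells_tree (place_bid a st p new).2]
    ((size a).+1 * (100 * m.+1)).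
Proof.
elim: a st => [|x a IH] [|[e o] st]; try by move=> _; run_nocall.
rewrite [all _ _]/= => /andP[/andP[/= le_e _] fits].
case: x => /=; last by run ltac:(eapply (IH _ fits)).
case lt_e: (e < p); rewrite leqNgt lt_e /=.
  by run ltac:(first [eapply computes_less | eapply (IH _ fits)]).
by case: e lt_e le_e => [|e] lt_e le_e;
  run ltac:(first [eapply computes_less | eapply (IH _ fits)]).
Qed.

Lemma computes_bidding m fuel W st : all (bid_fits m) W -> all (cell_fits m) st ->
  size W + load st < fuel ->
  computes prog BIDDING [args bids_tree W & cells_tree st]
    (cells_tree (bidding fuel W st)) (fuel * (300 * m.+1 ^ 2)).
Proof.
elim: fuel W st => [|fuel IH] // [|[a|] W] st /=.
- by move=> _ _ _; enter_body; [execute ltac:(fail) | rewrite expnS; lia].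
- move=> /andP[fits_a fits_W] fits_st lt_fuel.
  have run_max := computes_max_level a (leq0n m) fits_st.
  have run_place := computes_place_bid a (max_level a st 0) (Some a) fits_st.
  have /andP[fits_out fits_st'] :=
    place_bid_fits a (max_level a st 0) (fits_a : bid_fits m (Some a)) fits_st.
  have load_lt := @load_place_bid a st (Some a).
  have cost_place : (size a).+1 * (160 * m.+1) <= 160 * m.+1 ^ 2.
    by rewrite mulnCA leq_mul2l /= -mulnn leq_mul2r ltnS fits_a.
  case max_a: (max_level a st 0) => [|p] /=.
    have {}IH := IH W st fits_W fits_st ltac:(lia).
    by run ltac:(first [eapply run_max | eapply IH]).
  rewrite max_a in run_max run_place fits_out fits_st' load_lt.
  have {}load_lt := load_lt isT.
  move: (place_bid a st p.+1 (Some a)) run_place fits_out fits_st' load_lt => r.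
  move=> run_place fits_out fits_st' load_lt.
  have {}IH := IH (r.1 :: W) r.2 ltac:(by rewrite /= fits_out) fits_st'
    ltac:(rewrite /=; lia).
  by run ltac:(first [eapply run_max | eapply run_place | eapply IH]).
- move=> fits_W fits_st lt_fuel; have {}IH := IH W st fits_W fits_st ltac:(lia).
  by enter_body; [execute ltac:(eapply IH) | rewrite expnS; lia].
Qed.

Lemma computes_below m st i : all (cell_fits m) st ->
  computes prog BELOW [args cells_tree st & nat_tree i] (bits_tree (below st i))
    ((size st).+1 * (40 * m.+1)).
Proof.
elim: st => [|[e o] st IH]; first by move=> _; run_nocall.
rewrite [all _ _]/= => /andP[/andP[/= le_e _] /IH{}IH].
by run ltac:(first [eapply computes_less | eapply IH]).
Qed.

Lemma computes_exchange_bit m B x o y : bid_fits m o ->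
  computes prog EXCHANGE_BIT
    [args bool_tree x, bid_tree o, bool_tree y & bits_tree B]
    (bool_tree (exchange_bit B x o y)) (100 * m.+1).
Proof.
case: x; last by move=> _; run_nocall.
case: o => [row|] /= fits; last by run_nocall.
rewrite /bits_sub; case missing: (count id _) => [|k] /=; enter_body;
  by [execute ltac:(first [eapply computes_diff | eapply computes_count])
     | rewrite size_bits_diff; lia].
Qed.

Lemma computes_exchange m B S Q ys : all (bid_fits m) Q ->
  computes prog EXCHANGE
    [args bits_tree S, bids_tree Q, bits_tree ys & bits_tree B]
    (bits_tree (exchange_bits B S Q ys)) ((size S).+1 * (200 * m.+1)).
Proof.
elim: S Q ys => [|x S IH] [|o Q] [|y ys]; rewrite [all _ _]/= => fits;
  try by run_nocall.
case/andP: fits => fits_o /IH{}IH.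
by run ltac:(first [eapply (computes_exchange_bit _ _ _ fits_o) | eapply IH]).
Qed.

Lemma size_exchange_bits B S Q ys : size (exchange_bits B S Q ys) <= size S.
Proof. by rewrite size_map size_zip geq_minl. Qed.

Lemma computes_try_levels i S Q st m : all (bid_fits m) Q -> all (cell_fits m) st ->
  size S <= m -> size st <= m ->
  computes prog TRY_LEVELS
    [args nat_tree i, bits_tree S, bids_tree Q & cells_tree st]
    (bid_tree (try_levels i S Q st)) (i.+1 * (500 * m.+1 ^ 2)).
Proof.
move=> fits_Q fits_st le_S le_st; elim: i => [|i IH].
  by enter_body; [execute ltac:(fail) | rewrite expnS; lia].
set B := below st i.+1; set T := exchange_bits B S Q B.
have run_below := computes_below i.+1 fits_st; rewrite -/B in run_below.
have run_exchange := computes_exchange B S B fits_Q; rewrite -/T in run_exchange.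
have cost_below : (size st).+1 * (40 * m.+1) <= 40 * m.+1 ^ 2.
  by rewrite mulnCA leq_mul2l /= -mulnn leq_mul2r ltnS le_st.
have cost_exchange : (size S).+1 * (200 * m.+1) <= 200 * m.+1 ^ 2.
  by rewrite mulnCA leq_mul2l /= -mulnn leq_mul2r ltnS le_S.
have cost_count : m.+1 <= m.+1 ^ 2 by rewrite -mulnn leq_pmulr.
have size_T : size T <= size S := size_exchange_bits _ _ _ _.
have count_T := count_size id T.
rewrite [try_levels _ _ _ _]/= -/B -/T; case lt_T: (count id T < count id S);
  by run ltac:(first [eapply run_below | eapply run_exchange | eapply computes_count
    | eapply computes_less | eapply IH]).
Qed.

Lemma computes_half m : computes prog HALF (nat_tree m) (nat_tree m./2) (20 * m.+1).
Proof.
have [k] := ubnP m; elim: k m => // k IH [|[|m]] lt_mk; try by run_nocall.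
by have {}IH := IH m (ltnW lt_mk); run ltac:(eapply IH).
Qed.

Lemma computes_log m :
  computes prog LOG (nat_tree m) (nat_tree (up_log 2 m.+1)) (100 * m.+1).
Proof.
have [k] := ubnP m; elim: k m => // k IH [|m] lt_mk.
  by rewrite up_log1; run_nocall.
rewrite up_log2S //; have {}IH := IH m.+1./2 ltac:(lia).
by run ltac:(first [eapply (computes_half m.+1) | eapply IH]).
Qed.

Lemma computes_seed_length k l :
  computes prog SEED_LENGTH [args nat_tree k & nat_tree l]
    (nat_tree (beta.+1 * uphalf k + l)) ((10 + 2 * beta.+1) * k.+1).
Proof.
have [m] := ubnP k; elim: m k => // m IH [|[|k]] lt_km.
- by rewrite muln0; run_nocall.
- by rewrite muln1; run_nocall.
have {}IH := IH k (ltnW lt_km); rewrite /= mulnS -addnA.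
by run ltac:(eapply IH).
Qed.

Section Instance.
Variables (n : nat) (G : sgraph 'I_n) (S : {set 'I_n}).

Local Notation rows := (adj_rows G).
Local Notation Sb := (set_bits S).
Local Notation try_seed := (try_colouring beta rows Sb).

Lemma adj_rows_fit : all (fun r => size r <= n.+1) rows.
Proof. by rewrite all_map; apply/allP => i _ /=; rewrite size_set_bits. Qed.

Lemma size_adj_rows : size rows = n.
Proof. by rewrite size_map size_enum_ord. Qed.

Section Seed.
Variables (f w : bitseq) (X : nat).
Hypotheses (le_nX : n.+2 <= X) (le_fX : size f < X).

Local Notation budget := (beta.+1 * X ^ 4).
Local Notation g := (green_bits Sb f w).
Local Notation low := (low_bits beta rows).
Local Notation Q := (survivor_bids g (bits_diff g low) Sb rows g low).

Lemma leq_mul_budget i j a b e :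
  i + j <= 4 -> a <= X ^ i -> b <= X ^ j -> a * (e * b) <= e * budget.
Proof.
move=> le_ij4 le_a le_b; have X_gt0 : 0 < X by apply: leq_trans le_nX.
rewrite mulnCA leq_mul2l (leq_trans (leq_mul le_a le_b)) ?orbT //.
by rewrite -expnD (leq_trans (_ : _ <= X ^ 4)) ?leq_pmull // leq_pexp2l.
Qed.

Lemma survivor_bidsE : Q = vertex_bids G S (survivors G beta (green_set S f w)).
Proof.
rewrite green_bits_set_bits low_bits_adj_rows bits_diff_set_bits.
exact: survivor_bids_set_bits.
Qed.

Lemma survivor_bids_fit : all (bid_fits n.+1) Q.
Proof.
rewrite survivor_bidsE; apply: sub_all (vertex_bids_fit _ _ _) => -[a|] //=.
exact: leqW.
Qed.

Lemma computes_lfsr_colours :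
  computes prog LFSR [args bits_tree Sb, bits_tree w & bits_tree f]
    (bits_tree (lfsr (size Sb) w f)) (200 * budget).
Proof.
apply: eval_within_le (computes_lfsr _ _ _) _; rewrite size_set_bits.
by rewrite (@leq_mul_budget 1 1) // expn1 ltnW.
Qed.

Lemma computes_low : computes prog LOWS (rows_tree rows) (bits_tree low) (100 * budget).
Proof.
apply: eval_within_le (computes_lows adj_rows_fit) _; rewrite size_adj_rows.
have X_gt0 : 0 < X by apply: leq_trans le_nX.
have le_betaX : (n.+1 + beta).+1 <= beta.+1 * X.
  by rewrite -addSn mulSn leq_add ?leq_pmulr.
rewrite mulnCA leq_mul2l (leq_trans (leq_mul (ltnW le_nX) le_betaX)) ?orbT //.
by rewrite mulnCA mulnn leq_mul2l leq_pexp2l.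
Qed.

Lemma computes_survivor_bids :
  computes prog BIDS
    [args rows_tree rows, bits_tree g, bits_tree low, bits_tree g,
     bits_tree (bits_diff g low) & bits_tree Sb]
    (bids_tree Q) (300 * budget).
Proof.
apply: eval_within_le (computes_bids _ _ _ _ _ adj_rows_fit) _; rewrite size_adj_rows.
by rewrite (@leq_mul_budget 1 1) // expn1 ltnW.
Qed.

Lemma computes_auction :
  computes prog BIDDING [args bids_tree Q & cells_tree (initial_cells n)]
    (cells_tree (auction n Q)) (300 * budget).
Proof.
have run_bidding := computes_bidding survivor_bids_fit (initial_cells_fit n) (leqnn _).
apply: eval_within_le run_bidding _; rewrite (@leq_mul_budget 2 2) ?leq_exp2r //.
rewrite survivor_bidsE size_map size_enum_ord /load map_nseq sumn_nseq.
by rewrite (leq_trans _ (leq_mul le_nX le_nX)) //=; lia.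
Qed.

Lemma computes_levels :
  computes prog TRY_LEVELS
    [args nat_tree n.+1, bits_tree Sb, bids_tree Q & cells_tree (auction n Q)]
    (bid_tree (try_levels n.+1 Sb Q (auction n Q))) (500 * budget).
Proof.
have fits_auction := auction_fits survivor_bids_fit.
have le_S : size Sb <= n.+1 by rewrite size_set_bits.
have le_auction : size (auction n Q) <= n.+1 by rewrite size_auction.
have run_levels :=
  computes_try_levels n.+1 survivor_bids_fit fits_auction le_S le_auction.
by apply: eval_within_le run_levels _; rewrite (@leq_mul_budget 1 2) ?leq_exp2r ?expn1.
Qed.

Lemma computes_try_colouring :
  computes prog TRY_COLOURING
    [args bits_tree f, bits_tree w, rows_tree rows & bits_tree Sb]
    (bid_tree (try_seed f w)) (2000 * budget).
Proof.
have linear_le : n.+1 <= budget.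
  have := @leq_mul_budget 0 1 1 n.+1 1; rewrite !mul1n; apply=> //.
  by rewrite expn1 ltnW.
have run_size := computes_size Sb; have run_initial := computes_initial Sb n.+1.
rewrite !size_set_bits in run_size run_initial.
rewrite /try_colouring size_set_bits; enter_body.
  by execute ltac:(first [eapply computes_lfsr_colours | eapply computes_low
    | eapply computes_survivor_bids | eapply run_size | eapply run_initial
    | eapply computes_auction | eapply computes_levels | eapply computes_diff]).
rewrite size_bits_diff !size_set_bits; move: budget linear_le => Y linear_le.
by clear -linear_le; lia.
Qed.

End Seed.

Lemma leq_mul_addl a b c : 0 < c -> b <= c * (a + b).
Proof. by move=> c_gt0; rewrite (leq_trans (leq_addl a b)) ?leq_pmull. Qed.

(* The subtracted term pays for the overhead of the calls at the next level. *)
Lemma computes_search m f w X (K := 2000 * (beta.+1 * X ^ 4) + 400) :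
  n.+2 <= X -> size f + m < X ->
  computes prog SEARCH
    [args nat_tree m, bits_tree f, bits_tree w, rows_tree rows & bits_tree Sb]
    (bid_tree (search_seeds try_seed m f w)) (4 ^ m * K - 200).
Proof.
move=> le_nX; elim: m f w => [|m IH] f w le_mX.
  rewrite addn0 in le_mX; have run_try := computes_try_colouring w le_nX le_mX.
  by enter_body; [execute ltac:(eapply run_try) | rewrite mul1n /K; lia].
have {}IH x y := IH (x :: f) (y :: w) ltac:(by rewrite addSnnS).
have P_ge : 400 <= 4 ^ m * K by rewrite leq_mul_addl ?expn_gt0.
rewrite expnS -mulnA; move: (4 ^ m * K) P_ge IH => P P_ge IH.
rewrite [search_seeds _ _ _ _]/=.
case e00: (search_seeds _ m (false :: f) (false :: w)) (IH false false) => [T|] run00;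
 [|case e01: (search_seeds _ m (false :: f) (true :: w)) (IH false true) => [T|] run01;
 [|case e10: (search_seeds _ m (true :: f) (false :: w)) (IH true false) => [T|] run10;
   [|have run11 := IH true true]]];
 by enter_body;
   [ execute ltac:(first [eapply run00 | eapply run01 | eapply run10 | eapply run11])
   | clear -P_ge; lia ].
Qed.

Definition running_time (n k : nat) : nat :=
  let m := seed_length beta k n in
  4 ^ m * (2000 * (beta.+1 * (n + m + 2) ^ 4) + 400)
  + (10 + 2 * beta.+1) * k.+1 + 200 * n.+1.

Lemma computes_main k :
  computes prog MAIN
    [args rows_tree rows, bits_tree Sb, nat_tree k & Leaf]
    (bid_tree (search_seeds try_seed (seed_length beta k n) [::] [::]))
    (running_time n k).
Proof.
rewrite /running_time; set m := seed_length beta k n; set X := n + m + 2.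
have run_search : computes prog SEARCH _ _ _ :=
  @computes_search m [::] [::] X ltac:(rewrite /X; lia) ltac:(rewrite /X /=; lia).
have run_size := computes_size Sb; rewrite size_set_bits in run_size.
have P_ge : 400 <= 4 ^ m * (2000 * (beta.+1 * X ^ 4) + 400).
  by rewrite leq_mul_addl ?expn_gt0.
enter_body.
  by execute ltac:(first [eapply run_size | eapply computes_log
    | eapply computes_seed_length | eapply run_search]).
by move: (4 ^ m * _) P_ge => P P_ge; clear -P_ge; lia.
Qed.

End Instance.
End Program.

(** * Running time *)

Lemma exp2_up_log_le n : 2 ^ up_log 2 n.+1 <= 2 * n.+1.
Proof.
case: n => [|n]; first by rewrite up_log1.
rewrite up_log_trunc_log // expnS leq_mul2l /=; apply: leq_trans (leqnSn _).
exact: trunc_logP.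
Qed.

Section RunningTime.
Variables (beta n k : nat).

Local Notation m := (seed_length beta k n).

Lemma exp4_seed_length_le : 4 ^ m <= 2 ^ (beta.+1 * k.+1) * (2 * n.+1) ^ 2.
Proof.
rewrite -[4]/(2 ^ 2) -expnM mulnC mulnDl expnD; apply: leq_mul.
  by rewrite leq_exp2l // -mulnA leq_mul2l /=; lia.
by rewrite expnM leq_exp2r // exp2_up_log_le.
Qed.

Lemma seed_length_le : n + m + 2 <= (beta + 5) * (k.+1 * n.+1).
Proof.
have le_log : up_log 2 n.+1 <= n.+1 by apply/up_log_min/ltnW/ltn_expl.
have le_half : beta.+1 * uphalf k <= beta.+1 * (k.+1 * n.+1).
  by rewrite leq_mul2l; apply: leq_trans (_ : k.+1 <= _); [lia | rewrite leq_pmulr].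
have : n.+1 <= k.+1 * n.+1 by rewrite leq_pmull.
rewrite /seed_length; move: (k.+1 * n.+1) le_half => N le_half le_nN.
by rewrite -(addSnnS beta 4) mulnDl; lia.
Qed.

Definition running_time_constant : nat :=
  2 ^ beta.+1 * 4 * (2400 * (beta.+1 * (beta + 5) ^ 4)) + (10 + 2 * beta.+1) + 200.

Lemma running_time_le :
  running_time beta n k <=
  running_time_constant * (2 ^ (beta.+1 * k) * k.+1 ^ 4 * n.+1 ^ 6).
Proof.
set Y := _ * n.+1 ^ 6; have Y_gt0 : 0 < Y by rewrite !muln_gt0 !expn_gt0.
have le_k : k.+1 <= Y.
  apply: leq_trans (leq_pexp2l _ (isT : 1 <= 4)) _ => //.
  by rewrite /Y mulnAC leq_pmull // muln_gt0 !expn_gt0.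
have le_n : n.+1 <= Y.
  apply: leq_trans (leq_pexp2l _ (isT : 1 <= 6)) _ => //.
  by rewrite /Y leq_pmull // muln_gt0 !expn_gt0.
have le_base : 2000 * (beta.+1 * (n + m + 2) ^ 4) + 400
    <= 2400 * (beta.+1 * ((beta + 5) ^ 4 * (k.+1 ^ 4 * n.+1 ^ 4))).
  set Z := beta.+1 * ((beta + 5) ^ 4 * _).
  have Z_gt0 : 0 < Z by rewrite !muln_gt0 !addnS.
  have : beta.+1 * (n + m + 2) ^ 4 <= Z.
    by rewrite leq_mul2l -!expnMn leq_exp2r // seed_length_le.
  by move: (beta.+1 * _) Z Z_gt0 => W Z Z_gt0; lia.
rewrite /running_time_constant 2!(mulnDl _ _ Y).
apply: leq_add; last by rewrite leq_mul.
apply: leq_add; last by rewrite leq_mul.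
apply: leq_trans (leq_mul exp4_seed_length_le le_base) _.
rewrite /Y mulnS (expnD 2) expnMn (expnD n.+1 2 4); apply: eq_leq.
move: (2 ^ beta.+1) (2 ^ (beta.+1 * k)) (k.+1 ^ 4) (n.+1 ^ 2) (n.+1 ^ 4).
by move: ((beta + 5) ^ 4) => *; lia.
Qed.

End RunningTime.

(** * Fixed-parameter tractability *)

Lemma set_treeE n (A : {set 'I_n}) : set_tree A = bits_tree (set_bits A).
Proof. by rewrite /bits_tree /set_bits -map_comp. Qed.

Lemma pls_vc_encodeE x :
  pls_vc_encode x =
  [args rows_tree (adj_rows (graph x)), bits_tree (set_bits (cover x)),
   nat_tree (radius x) & Leaf].
Proof.
rewrite /pls_vc_encode /graph_tree /rows_tree /adj_rows -map_comp -set_treeE.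
by congr [args list_tree _ & _]; apply: eq_map => i; rewrite set_treeE.
Qed.

Lemma pls_program_correct beta (x : instance (pls_vc beta)) : valid x ->
  exists v t, [/\ runs (pls_program beta) (encode x) v t, answer x v
    & t <= running_time beta (nverts x) (radius x)].
Proof.
case: x => n G S k [/= coverS _ sep]; have [t run_t le_t] := computes_main beta G S k.
eexists; exists t; split; [by rewrite pls_vc_encodeE; exact: run_t | | exact: le_t].
case found: (search_seeds _ _ _ _) => [T|].
  have [f [w tried]] := search_seeds_some found.
  have [S' [-> cover' lt_S']] := try_colouring_some coverS tried.
  by right; exists S'; rewrite set_treeE.
left; split=> // -[S' [cover' le_k lt_S']].
by have := search_seeds_improving sep cover' lt_S' le_k; rewrite found.
Qed.

Lemma solvable_in_time_le (P : param_problem) (T T' : instance P -> nat) :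
  (forall x, valid x -> T x <= T' x) -> solvable_in_time T -> solvable_in_time T'.
Proof.
move=> le_T [p solved]; exists p => x x_valid.
have [v [t [run_t ans le_t]]] := solved x x_valid; exists v, t; split=> //.
exact: leq_trans le_t (le_T x x_valid).
Qed.

Lemma pls_vc_solvable beta : @solvable_in_time (pls_vc beta)
  (fun x : pls_vc_instance => running_time_constant beta
    * (2 ^ (beta.+1 * radius x) * (radius x).+1 ^ 4 * (nverts x).+1 ^ 6)).
Proof.
apply: (@solvable_in_time_le (pls_vc beta)
  (fun x : pls_vc_instance => running_time beta (nverts x) (radius x))).
  by move=> x _; apply: running_time_le.
by exists (pls_program beta); apply: pls_program_correct.
Qed.

Lemma ltn_nverts_tree_size x : nverts x < tree_size (pls_vc_encode x).
Proof.
have size_list l : size l < tree_size (list_tree l).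
  by elim: l => //= u l IH; rewrite ltnS (leq_trans IH) // leq_addl.
have := size_list [seq set_tree (neighbors (graph x) i) | i <- enum 'I_(nverts x)].
by rewrite size_map size_enum_ord => /leq_trans; apply; rewrite leqW ?leq_addr.
Qed.

Definition exp_program (C E : nat) : program :=
  [:: fun1 (fun k => If k is _ :: k' then (fun d => iter E (Call 1) (call1 0 k' d))
                     else succs C leaf);
      fun1 (fun m => If m is _ :: m' then node leaf (node leaf (call1 1 m'))
                     else leaf)].

Lemma computes_double C E m :
  exists T, computes (exp_program C E) 1 (nat_tree m) (nat_tree (2 * m)) T.
Proof.
elim: m => [|m [T IH]]; eexists; enter_body; try exact: leqnn.
  by execute ltac:(fail).
by rewrite mulnS; execute ltac:(exact: IH).
Qed.

Lemma eval_within_iter_double C E s e m T j :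
  eval_within (exp_program C E) s e (nat_tree m) T ->
  exists T', eval_within (exp_program C E) s (iter j (Call 1) e)
    (nat_tree (2 ^ j * m)) T'.
Proof.
move=> ev_e; elim: j => [|j [T' IH]]; first by exists T; rewrite mul1n.
have [T2 dbl] := computes_double C E (2 ^ j * m).
by eexists; rewrite expnS -mulnA; apply: eval_within_computes IH dbl.
Qed.

Lemma computes_const_exp C E k : exists T,
  computes (exp_program C E) 0 (nat_tree k) (nat_tree (C * 2 ^ (E * k))) T.
Proof.
elim: k => [|k [T IH]].
  by eexists; enter_body; [rewrite muln0 muln1; execute ltac:(fail) | exact: leqnn].
have ev_call : eval_within (exp_program C E) [:: Leaf; nat_tree k; nat_tree k.+1]
    (Call 0 (Var 1)) (nat_tree (C * 2 ^ (E * k))) (1 + T).+1.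
  by execute ltac:(exact: IH).
have [T' ev_iter] := eval_within_iter_double E ev_call.
eexists; enter_body; last exact: leqnn.
rewrite mulnS expnD mulnCA.
by eapply eval_within_case; [execute ltac:(fail) | exact: ev_iter].
Qed.

Lemma computable_const_exp C E : computable (fun k => C * 2 ^ (E * k)).
Proof.
exists (exp_program C E) => k.
by have [T [t run_t _]] := computes_const_exp C E k; exists t.
Qed.

Lemma exp_poly_le_exp q k N : 2 ^ (q * k) * k.+1 ^ 4 * N <= 2 ^ ((q + 4) * k) * N.
Proof.
rewrite leq_mul2r mulnDl expnD leq_mul2l (mulnC 4) (expnM 2 k 4) leq_exp2r //.
by rewrite ltn_expl ?orbT.
Qed.

Lemma leq_time_bound C k q n : 0 < k <= q ->
  C * (2 ^ q * k.+1 ^ 4 * n.+1 ^ 6) <= time_bound (16 * C + 6) q n.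
Proof.
case/andP=> k_gt0 le_kq; set c := 16 * C + 6; have c_ge6 : 6 <= c by rewrite leq_addl.
have le_k : k.+1 ^ 4 <= 16 * q ^ (c * trunc_log 2 q).
  apply: (@leq_trans ((2 * q) ^ 4)); first by rewrite leq_exp2r // mul2n; lia.
  rewrite expnMn leq_mul2l /=; have [-> | q_gt1] : q = 1 \/ 1 < q by lia.
    by rewrite !exp1n.
  rewrite leq_exp2l // -[4]muln1 leq_mul ?trunc_log_gt0 //; exact: leq_trans c_ge6.
have le_n : n.+1 ^ 6 <= n.+1 ^ c by rewrite leq_pexp2l.
apply: leq_trans (leq_mul (leqnn C) (leq_mul (leq_mul (leqnn (2 ^ q)) le_k) le_n)) _.
by rewrite (mulnCA _ 16) -(mulnA 16) mulnCA mulnA /time_bound leq_mul2r leq_addr orbT.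
Qed.

Theorem theorem4 (beta : nat) :
  fixed_parameter_tractable (pls_vc beta) /\
  exists c : nat,
    @solvable_in_time (pls_vc beta)
      (fun x : pls_vc_instance =>
         time_bound c (radius x + beta * radius x) (nverts x)).
Proof.
set C := running_time_constant beta; split.
  exists (fun k => C * 2 ^ ((beta.+1 + 4) * k)), 6.
  split; first exact: computable_const_exp.
  apply: solvable_in_time_le (pls_vc_solvable beta) => x _.
  rewrite -[leqRHS]mulnA leq_mul // (leq_trans (exp_poly_le_exp _ _ _)) // leq_mul //.
  by rewrite leq_exp2r // ltn_nverts_tree_size.
exists (16 * C + 6).
apply: solvable_in_time_le (pls_vc_solvable beta) => x [_ k_gt0 _].
by rewrite -mulSn; apply: leq_time_bound; rewrite k_gt0 leq_pmull.
Qed.
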